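(* Let $\beta>0$, $M>0$ and $$\mathcal{H}(\beta,M)=\left\{f=\sum_{l\ge0,\,0\le k\le2^l-1}f_{lk}\psi_{lk}:\ \sup_{l\ge0,\,0\le k\le2^l-1}2^{l(1/2+\beta)}|f_{lk}|\le M\right\}.$$ For $\epsilon\in[0,1]$ and $n\ge2$, suppose one observes $n$ i.i.d. processes $\{Y_{t,1}\}_{t\in[0,1]},\dots,\{Y_{t,n}\}_{t\in[0,1]}$ from $(1-\epsilon)P_f+\epsilon Q$, where $P_f$ is the law of the process $dY_t=f(t)\,dt+dW_t$, $t\in[0,1]$, with $W$ a standard Wiener process. Then there are constants $C,c>0$ such that $$\inf_{\hat f}\sup_{f\in\mathcal{H}(\beta,M),\,Q}\mathbb{P}_{(\epsilon,f,Q)}\left\{\|\hat f-f\|_\infty^2>C\left[\left(\frac{n}{\log n}\right)^{-\frac{2\beta}{2\beta+1}}\vee\epsilon^{\frac{4\beta}{2\beta+1}}\right]\right\}>c,$$ where the infimum is over all estimators $\hat f$ based on the $n$ observations and $Q$ ranges over all probability distributions.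
   Context: $\{\psi_{lk}\}_{l\ge0,0\le k\le2^l-1}$ is an orthonormal wavelet basis of $L^2[0,1]$ (the Cohen–Daubechies–Vial construction of wavelets on the interval). $\mathbb{P}_{(\epsilon,f,Q)}$ is the law under which the $n$ observed processes are i.i.d. from $(1-\epsilon)P_f+\epsilon Q$. $a\vee b=\max(a,b)$; $\|\cdot\|_\infty$ is the supremum norm on $[0,1]$. The constants $C,c$ do not depend on $n$ or $\epsilon$ (they may depend on $\beta$, $M$ and the basis). *)

(* Defs.v *)
From HB Require Import structures.
From mathcomp Require Import all_boot all_order all_algebra.
From mathcomp Require Import interval_inference.
From mathcomp Require Import all_classical all_reals all_analysis.
From mathcomp Require Import measurable_realfun.

Set Implicit Arguments.
Unset Strict Implicit.
Unset Printing Implicit Defensive.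

Import Order.TTheory GRing.Theory Num.Theory.
Import numFieldNormedType.Exports.

Local Open Scope classical_set_scope.
Local Open Scope ring_scope.

Section paths.
Context (R : realType).

Definition time : topologicalType := set_type (`[0, 1]%classic : set R).
Definition cpath := continuousType time R.

HB.instance Definition _ := Choice.on cpath.
HB.instance Definition _ := isPointed.Build cpath (mkcts (@cst_continuous time R 0)).

Definition path_eval (t : time) (w : cpath) : R := w t.

(* Generated by the evaluations; this is also the Borel sigma-algebra of the
   supremum norm. *)
Definition path_measurable : set (set cpath) :=
  <<s \bigcup_(t in [set: time])
        preimage_set_system [set: cpath] (path_eval t) measurable >>.

Let path_measurable0 : path_measurable set0.
Proof. exact: sigma_algebra0. Qed.

Let path_measurableC A : path_measurable A -> path_measurable (~` A).
Proof. exact: sigma_algebraC. Qed.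

Let path_measurableU (F : (set cpath)^nat) :
  (forall i, path_measurable (F i)) -> path_measurable (\bigcup_i F i).
Proof. exact: sigma_algebra_bigcup. Qed.

Definition path_display : measure_display.
Proof. by constructor. Qed.

HB.instance Definition _ := @isMeasurable.Build path_display cpath
  path_measurable path_measurable0 path_measurableC path_measurableU.

Lemma measurable_path_eval (t : time) : measurable_fun [set: cpath] (path_eval t).
Proof.
move=> _ Y mY; apply: sub_sigma_algebra; exists t => //.
by exists Y.
Qed.

Lemma measurable_to_path d (T : measurableType d) (X : T -> cpath) :
  (forall t, measurable_fun [set: T] (fun x => path_eval t (X x))) ->
  measurable_fun [set: T] X.
Proof.
move=> mX.
apply: (@measurability _ _ _ _ setT X
  (\bigcup_(t in [set: time])
     preimage_set_system [set: cpath] (path_eval t) measurable)) => //.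
move=> _ [_ [t _ [B mB <-]] <-].
by have := mX t measurableT _ mB; rewrite !setTI.
Qed.

End paths.
Arguments path_eval {R} t w.

Section white_noise.
Context (R : realType) d (Omega : measurableType d) (Pr : probability Omega R).
Notation mu := (@lebesgue_measure R).

Definition increment (W : Omega -> cpath R) (s t : time R) (w : Omega) : R :=
  W w t - W w s.

Definition standard_wiener (W : {RV Pr >-> cpath R}) : Prop :=
  [/\ forall t : time R, \val t = 0 -> {ae Pr, forall w, W w t = 0},
      forall (s t : time R) (B : set R), \val s < \val t -> measurable B ->
        Pr (increment W s t @^-1` B)
        = normal_prob 0 (Num.sqrt (\val t - \val s)) B
    & forall (m : nat) (t : nat -> time R) (B : nat -> set R),
        (forall i, (i < m)%N -> \val (t i) < \val (t i.+1)) ->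
        (forall i, measurable (B i)) ->
        Pr (\bigcap_(i in `I_m) (increment W (t i) (t i.+1) @^-1` B i))
        = (\prod_(i < m) Pr (increment W (t i) (t i.+1) @^-1` B i))%E].

Definition primitive (f : R -> R) (t : time R) : R :=
  (\int[mu]_(s in `[0, \val t]) f s)%R.

(* The zero path is a junk value for those f whose primitive is not
   continuous; see [driftE]. *)
Definition drift (f : R -> R) : cpath R :=
  match pselect (continuous (primitive f)) with
  | left fc => mkcts fc
  | right _ => point
  end.

Lemma driftE (f : R -> R) : mu.-integrable `[0, 1] (EFin \o f) ->
  forall t, drift f t = primitive f t.
Proof.
move=> intf t; rewrite /drift; case: pselect => // -[].
have /subspace_sigL_continuousP := parameterized_integral_continuous ler01 intf.
exact.
Qed.

Lemma signal_continuous (f : R -> R) (w : cpath R) :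
  continuous (fun t : time R => drift f t + w t).
Proof.
move=> t; apply: (@cvgD _ _ _ (nbhs t) (nbhs_filter t)).
  exact: (@cts_fun _ _ (drift f) t).
exact: (@cts_fun _ _ w t).
Qed.

Definition signal (f : R -> R) (W : {RV Pr >-> cpath R}) (w : Omega) : cpath R :=
  mkcts (@signal_continuous f (W w)).

Lemma measurable_signal f W : measurable_fun [set: Omega] (signal f W).
Proof.
apply: measurable_to_path => t.
apply: measurable_funD => //.
apply: (measurableT_comp (measurable_path_eval t)).
exact: measurable_funP.
Qed.

HB.instance Definition _ f W :=
  isMeasurableFun.Build _ _ _ _ (signal f W) (measurable_signal f W).

Definition signal_law (W : {RV Pr >-> cpath R}) (f : R -> R) :
    probability (cpath R) R :=
  distribution Pr (signal f W).

End white_noise.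

Section huber.
Context (R : realType) d (T : measurableType d).

Definition contaminate (eps : {i01 R}) (P Q : probability T R) (A : set T) :
    \bar R :=
  ((1 - eps%:num)%:E * P A + eps%:num%:E * Q A)%E.

Section instance.
Context (eps : {i01 R}) (P Q : probability T R).

Let mix : {measure set T -> \bar R} := msum (fun n =>
  if n is 0%N then mscale (1 - eps%:num)%:nng P else mscale eps%:num%:nng Q) 2.

Let contaminateE : contaminate eps P Q = mix.
Proof. by apply/funext => A; rewrite /= -/(measure_add _ _) measure_addE. Qed.

Let contaminate0 : contaminate eps P Q set0 = 0%E.
Proof. by rewrite contaminateE measure0. Qed.

Let contaminate_ge0 A : (0 <= contaminate eps P Q A)%E.
Proof. by rewrite contaminateE measure_ge0. Qed.

Let contaminate_sigma_additive : semi_sigma_additive (contaminate eps P Q).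
Proof. by rewrite contaminateE; exact: measure_semi_sigma_additive. Qed.

HB.instance Definition _ := isMeasure.Build _ _ _ (contaminate eps P Q)
  contaminate0 contaminate_ge0 contaminate_sigma_additive.

Let contaminateT : contaminate eps P Q [set: T] = 1%E.
Proof.
by rewrite /contaminate !probability_setT !mule1 -EFinD subrK.
Qed.

HB.instance Definition _ := Measure_isProbability.Build _ _ _
  (contaminate eps P Q) contaminateT.

End instance.

Definition tuple_cons n (x : T * n.-tuple T) : n.+1.-tuple T :=
  [tuple of x.1 :: x.2].

Lemma measurable_tuple_cons n :
  measurable_fun [set: T * n.-tuple T] (@tuple_cons n).
Proof. exact: measurable_cons. Qed.

HB.instance Definition _ n :=
  isMeasurableFun.Build _ _ _ _ (@tuple_cons n) (@measurable_tuple_cons n).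

Fixpoint iid (P : probability T R) (n : nat) : probability (n.-tuple T) R :=
  match n with
  | 0 => dirac [tuple]
  | m.+1 => distribution (P \x iid P m)%E (@tuple_cons m)
  end.

End huber.

Section cdv.
Context (R : realType).
Notation mu := (@lebesgue_measure R).

Definition dotL2 (A : set R) (f g : R -> R) : R :=
  (\int[mu]_(x in A) (f x * g x))%R.

(* Daubechies' scaling function and wavelet with N vanishing moments; the
   filter (h_n), -N < n <= N, is stored as [h i] with n = i + 1 - N, and the
   wavelet filter is g_n = (-1)^n h_(1-n).  Right-continuity selects, among
   the almost everywhere equal solutions, the indicator of [0,1[ when N = 1
   and the continuous one when N >= 2. *)
Definition daubechies (N : nat) (phi psi : R -> R) : Prop :=
  [/\ (0 < N)%N,
      right_continuous phi,
      forall x, x \notin `[1 - N%:R, N%:R] -> phi x = 0,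
      (\int[mu]_x phi x)%R = 1
    & forall k : int, dotL2 setT phi (fun x => phi (x - k%:~R)) = (k == 0)%:R] /\
  (exists h : nat -> R, forall x,
      phi x = Num.sqrt 2 * \sum_(i < N.*2) h i * phi (2 * x - i%:R + N%:R - 1)
      /\
      psi x = Num.sqrt 2 * \sum_(i < N.*2)
        (-1) ^+ (i + N + 1) * h (N.*2.-1 - i)%N
        * phi (2 * x - i%:R + N%:R - 1)) /\
  (forall p, (p < N)%N -> (\int[mu]_x (x ^+ p * psi x))%R = 0).

(* The N edge functions which, restricted to [0,+oo[, restore the polynomials
   of degree < N to the span of the interior translates phi(x - m), m >= N. *)
Definition edge_fun (N : nat) (phi : R -> R) (p : nat) (x : R) : R :=
  \sum_(n < N.*2.-1) 'C(n, p)%:R * phi (x + n%:R - N%:R + 1).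

Definition orthonormal_on (A : set R) (N : nat) (u : nat -> R -> R) : Prop :=
  forall i j, (i < N)%N -> (j < N)%N -> dotL2 A (u i) (u j) = (i == j)%:R.

(* Scaling functions [su] and wavelets [wu] at the edge 0 of the half-line:
   [su] is the Gram-Schmidt orthonormalisation of the edge functions, taken in
   the order N-1, ..., 0 (whence the triangular matrix [a]), and [wu] is the
   orthonormal family with staggered supports [0, N + i] completing the
   interior wavelets psi(x - m), m >= N, to a basis of the orthogonal
   complement of V_0 in V_1.  Both are determined up to signs. *)
Definition cdv_edge (N : nat) (phi psi : R -> R) (su wu : nat -> R -> R) : Prop :=
  let A := (`[0, +oo[%classic : set R) in
  (exists a : nat -> nat -> R,
      (forall i p, (i + p < N.-1)%N -> a i p = 0) /\
      (forall i x, (i < N)%N -> 0 <= x ->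
        su i x = \sum_(p < N) a i p * edge_fun N phi p x)) /\
  (exists G g : nat -> nat -> R, forall i x, (i < N)%N -> 0 <= x ->
      wu i x = Num.sqrt 2 *
        (\sum_(p < N) G i p * su p (2 * x) +
         \sum_(N <= m < (N + i.*2).+1) g i m * phi (2 * x - m%:R))) /\
  [/\ orthonormal_on A N su,
      orthonormal_on A N wu,
      forall i p, (i < N)%N -> (p < N)%N -> dotL2 A (wu i) (su p) = 0,
      forall i m, (i < N)%N -> (N <= m)%N ->
        dotL2 A (wu i) (fun x => phi (x - m%:R)) = 0
    & forall i m, (i < N)%N -> (N <= m)%N ->
        dotL2 A (wu i) (fun x => psi (x - m%:R)) = 0].

Definition reflect_fun (u : R -> R) (x : R) : R := u (1 - x).

(* k-th of the 2^j functions of level j: N at the left edge, N at the right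
   edge, and translates of [inner] in between. *)
Definition cdv_level (N : nat) (inner : R -> R) (left right : nat -> R -> R)
    (j k : nat) (x : R) : R :=
  Num.sqrt (2 ^+ j) *
    (if (k < N)%N then left k (2 ^+ j * x)
     else if (k < 2 ^ j - N)%N then inner (2 ^+ j * x - k%:R)
     else right (2 ^ j - k.+1)%N (2 ^+ j * (1 - x))).

(* All the functions of the construction in a single sequence: the 2^J scaling
   functions of the coarsest level J come first and, for j >= J, the wavelets
   of level j are those of rank 2^j + k, 0 <= k < 2^j. *)
Definition cdv_seq (N J : nat) (phi psi : R -> R) (sl wl sr wr : nat -> R -> R)
    (m : nat) : R -> R :=
  let j := trunc_log 2 m in
  if (m < 2 ^ J)%N then cdv_level N phi sl sr J m
  else cdv_level N psi wl wr j (m - 2 ^ j)%N.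

Definition wavelet_index : set (nat * nat) :=
  [set lk | (lk.2 < 2 ^ lk.1)%N].

(* A family indexed by l >= 0, 0 <= k < 2^l consisting of the functions of the
   construction.  There are 2^L functions of level < L in the construction
   (the scaling functions included) and 2^L - 1 indices (l,k) with l < L, so
   the functions must be relabelled; any relabelling that moves the levels by
   a bounded amount is allowed, which changes the Hoelder balls only through
   the value of the radius. *)
Definition cdv_wavelets (Psi : nat -> nat -> R -> R) : Prop :=
  exists (N J : nat) (phi psi : R -> R) (sl wl sr wr : nat -> R -> R)
         (sigma : nat * nat -> nat) (D : nat),
  [/\ daubechies N phi psi,
      (N.*2 <= 2 ^ J)%N,
      cdv_edge N phi psi sl wl
    & cdv_edge N (reflect_fun phi) (reflect_fun psi) sr wr] /\
  [/\ set_bij wavelet_index [set: nat] sigma,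
      forall l k, (k < 2 ^ l)%N ->
        (l <= trunc_log 2 (sigma (l, k)) + D)%N /\
        (trunc_log 2 (sigma (l, k)) <= l + D)%N
    & forall l k x, (k < 2 ^ l)%N -> 0 <= x <= 1 ->
        Psi l k x = cdv_seq N J phi psi sl wl sr wr (sigma (l, k)) x].

Definition orthonormal_basis01 (Psi : nat -> nat -> R -> R) : Prop :=
  let I := (`[0, 1]%classic : set R) in
  [/\ forall l k, (k < 2 ^ l)%N -> measurable_fun I (Psi l k),
      forall l k l' k', (k < 2 ^ l)%N -> (k' < 2 ^ l')%N ->
        dotL2 I (Psi l k) (Psi l' k') = ((l, k) == (l', k'))%:R
    & forall f : R -> R, measurable_fun I f ->
        mu.-integrable I (fun x => (f x ^+ 2)%:E) ->
        (\int[mu]_(x in I) (f x - \sum_(l < L) \sum_(k < 2 ^ l)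
            dotL2 I f (Psi l k) * Psi l k x) ^+ 2)%R @[L --> \oo] --> (0 : R)].

(* The expansion holds at every point of [0,1], and not merely in L^2, because
   the loss is a genuine supremum.  The values of f outside [0,1] are
   irrelevant. *)
Definition holder_ball (Psi : nat -> nat -> R -> R) (beta M : R) : set (R -> R) :=
  [set f | exists a : nat -> nat -> R,
     (forall l k, (k < 2 ^ l)%N ->
        2 `^ (l%:R * (2^-1 + beta)) * `|a l k| <= M) /\
     (forall x, 0 <= x <= 1 ->
        (\sum_(l < L) \sum_(k < 2 ^ l) a l k * Psi l k x) @[L --> \oo] --> f x)].

Definition supdist01 (g f : R -> R) : \bar R :=
  ereal_sup [set `|g x - f x|%:E | x in `[0, 1]%classic].

(* Measurability is only required of the losses that enter the risk, so that
   the infimum is over the largest class for which the risk makes sense. *)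
Definition estimator (H : set (R -> R)) (n : nat) :
    set (n.-tuple (cpath R) -> R -> R) :=
  [set fhat | forall f, H f ->
     measurable_fun [set: n.-tuple (cpath R)]
       (fun y => supdist01 (fhat y) f)].

Arguments estimator H n : clear implicits.

Definition minimax_excess (H : set (R -> R)) d (Omega : measurableType d)
    (Pr : probability Omega R) (W : {RV Pr >-> cpath R})
    (n : nat) (eps : {i01 R}) (r : R) : \bar R :=
  ereal_inf [set
    ereal_sup [set
      iid (contaminate eps (signal_law W fQ.1) fQ.2) n
        [set y | (r%:E < supdist01 (fhat y) fQ.1 ^+ 2)%E]
      | fQ in H `*` [set: probability (cpath R) R]]
    | fhat in estimator H n].

End cdv.

(* Main.v *)
Require Import Defs.
From HB Require Import structures.
From mathcomp Require Import all_boot all_order all_algebra.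
From mathcomp Require Import interval_inference.
From mathcomp Require Import all_classical all_reals all_analysis.
From mathcomp Require Import measurable_realfun.
From mathcomp Require Import ring lra zify.

Set Implicit Arguments.
Unset Strict Implicit.
Unset Printing Implicit Defensive.

Import Order.TTheory GRing.Theory Num.Theory.
Import numFieldNormedType.Exports.

Local Open Scope classical_set_scope.
Local Open Scope ring_scope.

(** The lower bound is the maximum of two terms, and each is forced by its own
    family of signals, all of them multiples [g * Psi l k] of single wavelets.

    Both families rest on one estimate.  For a signal [f] with finite energy,
    the density [L] of the law [P_f] of the noisy path with respect to the law
    [P_0] of the pure noise satisfies [E_0 (L^2) = exp (|f|^2)] (Cameron and
    Martin), so that, by Cauchy-Schwarz,
      [(int h dP_f)^2 <= exp (|f|^2) * int h^2 dP_0]   for all [h >= 0].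
    Only this inequality, called [chi2_le], is needed, and it can be had without
    constructing [L].  It holds for Gaussian shifts on the line
    ([chi2_le_normal]), it passes to products by Fubini ([chi2_le_prod]), hence
    to the finitely many increments of a path along a grid, and since it only
    compares integrals it extends from the algebra of cylinder sets to the whole
    sigma-algebra of the path space ([chi2_le_algebra], [chi2_le_signal_law]).
    Using the product rule once more gives the factor [exp (n * |f|^2)] for [n]
    independent paths.

    Sampling term.  At resolution level [j] there are [K] wavelets, [K] of order [2^j],
    with disjoint supports and supremum about [2^(j/2)] ([separated_wavelets]).
    An estimator with small risk would tell the corresponding signals apart, that
    is, produce [K] disjoint events, each likely under its own signal.  One
    of these events has null probability at most [1 / K], and [chi2_le] then
    makes it unlikely under its own signal as soon as [4 * exp (n * g^2) <= K]
    ([unlikely_event], [minimax_excess_many]).  Here the contamination is taken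
    equal to the uncontaminated law.

    Contamination term.  A signal whose law is within [eps] of [P_0] in total
    variation can be hidden completely: suitable contaminations [Q0] and [Q1]
    make both contaminated laws equal ([hidden_change]), whatever [n] is.  By
    [chi2_le_total_variation] this is so when [g] is a small multiple of [eps].

    In both cases the constraint has the form [g^2 <= alpha / x], with
    [x = n / ln n] or [x = eps^-2].  Since [g] may be as large as a multiple of
    [2^(- j * (1/2 + beta))] in the ball, the best level is the one where
    [2^(j * (2 * beta + 1))] is of order [x], and the squared sup-norm
    [g^2 * 2^j] is then of order [x^(- 2 * beta / (2 * beta + 1))]
    ([spikes_at_scale]). *)

(** * The second-moment order between measures *)

Section chi2_le.
Context (R : realType).
Local Open Scope ereal_scope.

(** When [P] has a density with respect to [Q], this says that the density has
    second moment at most [c] under [Q]; the formulation through integrals needs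
    no density and is stable under products, images and limits. *)
Definition chi2_le d (T : measurableType d) (P Q : {measure set T -> \bar R})
    (c : R) : Prop :=
  forall g : T -> \bar R, measurable_fun [set: T] g -> (forall x, 0 <= g x) ->
    (\int[P]_x g x) ^+ 2 <= c%:E * \int[Q]_x (g x ^+ 2).

Lemma measurable_fun_expe2 d (T : measurableType d) (g : T -> \bar R) :
  measurable_fun [set: T] g -> measurable_fun [set: T] (fun x => g x ^+ 2).
Proof. by move=> mg; under eq_fun do rewrite expe2;
  exact: emeasurable_funM. Qed.

Lemma expe2_ge0 (x : \bar R) : 0 <= x -> 0 <= x ^+ 2.
Proof. by move=> x0; rewrite expe2 mule_ge0. Qed.

Lemma lee_sqr (x y : \bar R) : 0 <= x -> x <= y -> x ^+ 2 <= y ^+ 2.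
Proof. by move=> x0 xy; rewrite !expe2; apply: lee_pmul. Qed.

Lemma chi2_le_eq d (T : measurableType d) (P Q P' Q' : {measure set T -> \bar
  R})
    (c : R) :
  (forall A, measurable A -> P A = P' A) ->
  (forall A, measurable A -> Q A = Q' A) ->
  chi2_le P Q c -> chi2_le P' Q' c.
Proof.
move=> PP' QQ' PQ g mg g0.
have <- : \int[P]_x g x = \int[P']_x g x.
  by apply: eq_measure_integral => A mA _; exact: PP'.
have <- : \int[Q]_x (g x ^+ 2) = \int[Q']_x (g x ^+ 2).
  by apply: eq_measure_integral => A mA _; exact: QQ'.
exact: PQ.
Qed.

Lemma chi2_le_mono d (T : measurableType d) (P Q : {measure set T -> \bar R})
    (c c' : R) : (c <= c')%R -> chi2_le P Q c -> chi2_le P Q c'.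
Proof.
move=> cc' PQ g mg g0; apply: le_trans (PQ g mg g0) _.
rewrite lee_wpmul2r ?lee_fin//.
by apply: integral_ge0 => x _; exact: expe2_ge0.
Qed.

Lemma chi2_le_distribution d d' (T : measurableType d) (T' : measurableType d')
    (P Q : probability T R) (c : R) (X : {mfun T >-> T'}) :
  chi2_le P Q c -> chi2_le (distribution P X) (distribution Q X) c.
Proof.
move=> PQ g mg g0; rewrite !ge0_integral_distribution//; last 2 first.
- exact: measurable_fun_expe2.
- by move=> y; exact: expe2_ge0.
by apply: PQ => [|x]; [exact: measurableT_comp|exact: g0].
Qed.

(** Fubini: the inequality for the second factor, applied to the sections of [g],
    bounds the square of the inner integral that the first factor has to handle. *)
Lemma chi2_le_prod d1 d2 (T1 : measurableType d1) (T2 : measurableType d2)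
    (P1 Q1 : probability T1 R) (P2 Q2 : probability T2 R) (c1 c2 : R) :
  (0 <= c1)%R -> (0 <= c2)%R -> chi2_le P1 Q1 c1 -> chi2_le P2 Q2 c2 ->
  chi2_le (P1 \x P2) (Q1 \x Q2) (c1 * c2)%R.
Proof.
move=> c1_ge0 c2_ge0 PQ1 PQ2 g mg g0.
have g20 x : 0 <= g x ^+ 2 by exact: expe2_ge0.
have mg2 := measurable_fun_expe2 mg.
rewrite !fubini_tonelli1//.
apply: le_trans (PQ1 _ _ _) _.
- exact: measurable_fun_fubini_tonelli_F.
- by move=> x; exact: integral_ge0.
rewrite EFinM -muleA lee_wpmul2l ?lee_fin// -ge0_integralZl//; last 2 first.
- exact: measurable_fun_fubini_tonelli_F.
- by move=> x _; exact: integral_ge0.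
apply: ge0_le_integral => //.
- by move=> x _; apply/expe2_ge0/integral_ge0.
- by apply/measurable_fun_expe2/measurable_fun_fubini_tonelli_F.
- by apply: measurable_funeM; exact: measurable_fun_fubini_tonelli_F.
- by move=> x _; apply: PQ2 => //; exact: measurableT_comp.
Qed.

Lemma chi2_le_dirac d (T : measurableType d) (x : T) (c : R) :
  (1 <= c)%R -> chi2_le (\d_x : probability T R) (\d_x : probability T R) c.
Proof.
move=> c_ge1 g mg g0; rewrite !integral_dirac//;
  last exact: measurable_fun_expe2.
by rewrite !diracT !mul1e lee_pemull ?lee_fin// expe2_ge0.
Qed.

End chi2_le.

Section product_law.
Context (R : realType) d (T : measurableType d).

(** The recursion is that of [iid], so that both the increments of one path and
    the sample of paths are covered by the same lemmas. *)
Fixpoint product_law (P : nat -> probability T R) (n : nat) :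
    probability (n.-tuple T) R :=
  match n with
  | 0 => dirac [tuple]
  | m.+1 => distribution (P 0%N \x product_law (P \o succn) m)%E (@tuple_cons _
    T m)
  end.

Lemma iidE (P : probability T R) n : iid P n = product_law (fun=> P) n.
Proof. by elim: n => //= n ->. Qed.

Lemma chi2_le_product_law (P Q : nat -> probability T R) (c : nat -> R) n :
  (forall i, 0 <= c i) -> (forall i, (i < n)%N -> chi2_le (P i) (Q i) (c i)) ->
  chi2_le (product_law P n) (product_law Q n) (\prod_(i < n) c i).
Proof.
elim: n P Q c => [|n IH] P Q c c_ge0 PQ /=.
  by rewrite big_ord0; apply: chi2_le_dirac; exact: lexx.
rewrite big_ord_recl; apply: chi2_le_distribution.
apply: chi2_le_prod => //; [exact: prodr_ge0|exact: PQ|].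
by apply: (IH (P \o succn) (Q \o succn) (c \o succn)) => [i|i ltin];
  [exact: c_ge0|exact: PQ].
Qed.

Lemma chi2_le_iid (P Q : probability T R) (c : R) n :
  0 <= c -> chi2_le P Q c -> chi2_le (iid P n) (iid Q n) (c ^+ n).
Proof.
move=> c_ge0 PQ; rewrite !iidE -[n in c ^+ n]card_ord -prodr_const.
exact: (@chi2_le_product_law _ _ (fun=> c)).
Qed.

Definition box n (B : nat -> set T) : set (n.-tuple T) :=
  [set y | forall i : 'I_n, B i (tnth y i)].

Arguments box : clear implicits.

Lemma measurable_box n (B : nat -> set T) :
  (forall i, measurable (B i)) -> measurable (box n B).
Proof.
move=> mB; have -> : box n B =
    \bigcap_(i in [set: 'I_n]) ((fun y : n.-tuple T => tnth y i) @^-1` B i).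
  by apply/seteqP; split => y Hy i; [move=> _; exact: Hy|exact: Hy].
apply: fin_bigcap_measurable => // i _.
by rewrite -[X in measurable X]setTI; exact: measurable_tnth.
Qed.

Lemma product_law_box (P : nat -> probability T R) n (B : nat -> set T) :
  (forall i, measurable (B i)) ->
  product_law P n (box n B) = (\prod_(i < n) P i (B i))%E.
Proof.
elim: n P B => [|n IH] P B mB /=.
  by rewrite big_ord0 diracE mem_set// => -[].
rewrite big_ord_recl /distribution /pushforward/=.
have -> : (\prod_(i < n) P (bump 0 i) (B (bump 0 i)) =
           product_law (P \o succn) n (box n (B \o succn)))%E.
  by rewrite IH// => i; exact: mB.
rewrite -product_measure1E//; last by apply: measurable_box => i; exact: mB.
congr (_ _).
apply/seteqP; split => [[x y] H|[x y] [/= Bx By]].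
  split => /=.
    exact: (H ord0).
  by move=> i; have := H (lift ord0 i); rewrite tnthS.
move=> i; case: (unliftP ord0 i) => [j ->|->]; rewrite ?tnth0 ?tnthS//=.
exact: By.
Qed.

(** Boxes are stable under intersection and generate the sigma-algebra of
    tuples. *)
Lemma eq_measure_box n (m1 m2 : probability (n.-tuple T) R) :
  (forall B : nat -> set T, (forall i, measurable (B i)) ->
     m1 (box n B) = m2 (box n B)) ->
  forall A, measurable A -> m1 A = m2 A.
Proof.
move=> eqm.
pose G := [set A | exists2 B : nat -> set T, (forall i, measurable (B i)) &
                     A = box n B].
have GT : G setT by exists (fun=> setT) => //; apply/seteqP; split.
apply: (@measure_unique _ _ _ G (fun=> setT)) => //.
- apply/seteqP; split.
    apply: smallest_sub; first exact: smallest_sigma_algebra.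
    rewrite -bigcup_seq => _ [i _ [B mB <-]]; apply: sub_sigma_algebra.
    (* a constraint on one coordinate is a box with full sides elsewhere *)
    exists (fun j : nat => if j == i then B else setT) => [j|];
      first by case: ifP.
    rewrite setTI; apply/seteqP; split => y /= Hy.
      by move=> j /=; case: eqP => // /val_inj ->.
    by have /= := Hy i; rewrite eqxx.
  apply: smallest_sub; first exact: sigma_algebra_measurable.
  by move=> _ [B mB ->]; exact: measurable_box.
- move=> _ _ [B mB ->] [B' mB' ->].
  exists (fun i => B i `&` B' i) => [i|]; first exact: measurableI.
  apply/seteqP; split => y.
    by move=> [Hy Hy'] i; split.
  by move=> Hy; split => i; case: (Hy i).
- by rewrite bigcup_const.
- by move=> _ [B mB ->]; exact: eqm.
- by move=> _ /=; rewrite probability_setT ltry.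
Qed.

End product_law.

(** * Gaussian shifts on the line *)

Section density.
Context d (T : measurableType d) (R : realType).
Local Open Scope ereal_scope.
Import HBNNSimple.

(** Splitting an integral along the level sets of a simple factor; it is used for
    the density and for the constant function. *)
Lemma ge0_integral_nnsfunE (nu : {measure set T -> \bar R}) (h : {nnsfun T >->
  R})
    (f : T -> \bar R) : measurable_fun setT f -> (forall x, 0 <= f x) ->
  \int[nu]_x ((h x)%:E * f x) =
  \sum_(r \in range h) r%:E * \int[nu]_(x in h @^-1` [set r]) f x.
Proof.
move=> mf f0.
transitivity (\int[nu]_x \sum_(r \in range h)
    ((r * \1_(h @^-1` [set r]) x)%:E * f x)).
  apply: eq_integral => x _.
  rewrite fimfunE -fsumEFin// ge0_mule_fsuml// => r.
  by rewrite EFinM nnfun_muleindic_ge0.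
rewrite ge0_integral_fsum//; last 2 first.
- move=> r; apply: emeasurable_funM => //.
  by apply/measurable_EFinP; do 2 apply/measurableT_comp => //.
- by move=> r x _; rewrite mule_ge0// EFinM nnfun_muleindic_ge0.
apply: eq_fsbigr => r /[!inE] -[y _ <-].
under eq_integral do rewrite EFinM -muleA.
rewrite ge0_integralZl//; last 3 first.
- apply: emeasurable_funM => //.
  by apply/measurable_EFinP; exact: measurable_indic.
- by move=> x _; rewrite mule_ge0// lee_fin.
- by rewrite lee_fin.
congr (_ * _); rewrite [RHS]integral_mkcond.
by apply: eq_integral => x _; rewrite epatch_indic/= muleC.
Qed.

Lemma ge0_integral_density (nu mu : {measure set T -> \bar R}) (f : T -> R)
    (g : T -> \bar R) :
  measurable_fun setT f -> (forall x, 0 <= f x)%R ->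
  (forall A, measurable A -> nu A = \int[mu]_(x in A) (f x)%:E) ->
  measurable_fun setT g -> (forall x, 0 <= g x) ->
  \int[nu]_x g x = \int[mu]_x (g x * (f x)%:E).
Proof.
move=> mf f0 nuE mg g0; have /measurable_EFinP mEf := mf.
have hE (h : {nnsfun T >-> R}) :
    \int[nu]_x (h x)%:E = \int[mu]_x ((h x)%:E * (f x)%:E).
  transitivity (\int[nu]_x ((h x)%:E * cst 1 x)).
    by apply: eq_integral => x _; rewrite mule1.
  rewrite !ge0_integral_nnsfunE//; apply: eq_fsbigr => r _.
  by rewrite integral_cst// mul1e nuE.
pose h_ := nnsfun_approx measurableT mg.
have cvgh x : (h_ n x)%:E @[n --> \oo] --> g x by exact: cvg_nnsfun_approx.
have ndh x : {homo (fun n => (h_ n x)%:E) : m n / (m <= n)%N >-> m <= n}.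
  by move=> m n mn; rewrite lee_fin; exact/lefP/nd_nnsfun_approx.
transitivity (lim (\int[nu]_x (h_ n x)%:E @[n --> \oo])).
  rewrite -monotone_convergence//=.
  - by apply: eq_integral => x _; apply/esym/cvg_lim => //; exact: cvgh.
  - by move=> n; exact/measurable_EFinP.
  - by move=> n x _; rewrite lee_fin.
under eq_fun do rewrite hE.
rewrite -monotone_convergence//=.
- by apply: eq_integral => x _; apply/cvg_lim => //; exact: cvgeZr.
- by move=> n; apply: emeasurable_funM => //; exact/measurable_EFinP.
- by move=> n x _; rewrite mule_ge0// lee_fin.
- by move=> x _ m n mn; rewrite lee_wpmul2r ?lee_fin//; exact: ndh.
Qed.

End density.

Section gaussian.
Context (R : realType).
Notation mu := (@lebesgue_measure R).
Local Open Scope ereal_scope.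

(** Cauchy-Schwarz in its linearised form: an inequality
    [2 * I <= u * G + c / u] for every [u > 0] is optimal at [u = sqrt (c / G)].
    The linear form survives termwise integration and limits. *)
Lemma sqr_le_of_linear (I G : \bar R) (c : R) : 0 <= I -> 0 <= G -> (0 < c)%R ->
  (forall u : R, (0 < u)%R -> 2%:E * I <= u%:E * G + (c / u)%:E) ->
  I ^+ 2 <= c%:E * G.
Proof.
move=> I0; case: G => [G| |//]; last by move=> _ c0 _;
  rewrite gt0_muley ?lte_fin// leey.
rewrite lee_fin => G0 c0 lin.
case: I I0 lin => [I| |//]; last first.
  by move=> _ /(_ _ ltr01); rewrite gt0_muley ?lte_fin// -EFinM -EFinD.
rewrite lee_fin => I0 lin.
have {}lin u : (0 < u -> 2 * I <= u * G + c / u)%R by move=> /lin;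
  rewrite -!EFinM.
rewrite -EFin_expe -EFinM lee_fin.
have [G00|Gneq0] := eqVneq G 0%R.
  rewrite G00 mulr0; suff -> : I = 0%R by rewrite expr0n.
  apply/eqP; rewrite eq_le I0 andbT leNgt; apply/negP => I_gt0.
  have := lin (c / I)%R (divr_gt0 c0 I_gt0).
  by rewrite G00 mulr0 add0r invf_div mulrCA divff ?gt_eqF// mulr1; lra.
have Ggt0 : (0 < G)%R by rewrite lt_neqAle eq_sym Gneq0.
pose w := Num.sqrt (c * G).
have w2 : (w ^+ 2 = c * G)%R by rewrite sqr_sqrtr// mulr_ge0// ltW.
have w0 : (0 < w)%R by rewrite sqrtr_gt0 mulr_gt0.
have := lin (w / G)%R (divr_gt0 w0 Ggt0).
have -> : (w / G * G + c / (w / G) = 2 * w)%R.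
  have -> : (c = w ^+ 2 / G)%R by rewrite w2 mulfK.
  by field; rewrite !gt_eqF.
by move=> ?; rewrite -w2 ler_pXn2r ?nnegrE ?(ltW w0)//; lra.
Qed.

Lemma normal_pdf_gt0 (m s x : R) : s != 0%R -> (0 < normal_pdf m s x)%R.
Proof. by move=> s0; rewrite normal_pdfE// mulr_gt0 ?normal_peak_gt0 ?expR_gt0.
  Qed.

(** Completing the square.  Dividing by the centred density and integrating gives
    the second moment [expR (a ^+ 2 / s ^+ 2)] of the likelihood ratio. *)
Lemma sqr_normal_pdf (a s x : R) : s != 0%R ->
  (normal_pdf a s x ^+ 2 =
   expR (a ^+ 2 / s ^+ 2) * normal_pdf (2 * a) s x * normal_pdf 0 s x)%R.
Proof.
move=> s0; rewrite !normal_pdfE// /normal_fun exprMn -expRM_natl.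
rewrite [RHS](_ : _ = normal_peak s ^+ 2 * (expR (a ^+ 2 / s ^+ 2) *
  expR (- (x - 2 * a) ^+ 2 / (s ^+ 2 *+ 2)) *
  expR (- (x - 0) ^+ 2 / (s ^+ 2 *+ 2))))%R; last by ring.
by rewrite -!expRD; congr (_ * expR _)%R; field.
Qed.

(** Pointwise, [2 * g * p_a <= u * g^2 * p_0 + p_a^2 / (u * p_0)], and the last
    quotient is a multiple of the density with mean [2 * a]. *)
Lemma chi2_le_normal (a s : R) : s != 0%R ->
  chi2_le (normal_prob a s) (normal_prob 0 s) (expR (a ^+ 2 / s ^+ 2)).
Proof.
move=> s0 g mg g0.
have mg2 := measurable_fun_expe2 mg.
have mpdf m : measurable_fun setT (fun x : R => (normal_pdf m s x)%:E).
  by apply/measurable_EFinP; exact: measurable_normal_pdf.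
have pdf0 m x : 0 <= (normal_pdf m s x)%:E by rewrite lee_fin normal_pdf_ge0.
apply: sqr_le_of_linear.
- exact: integral_ge0.
- by apply: integral_ge0 => x _; exact: expe2_ge0.
- exact: expR_gt0.
move=> u u0.
have dens m (h : R -> \bar R) : measurable_fun setT h -> (forall x, 0 <= h x) ->
    \int[normal_prob m s]_x h x = \int[mu]_x (h x * (normal_pdf m s x)%:E).
  apply: (@ge0_integral_density _ (measurableTypeR R) R (normal_prob m s) mu)
    => // [|x]; last exact: normal_pdf_ge0.
  exact: measurable_normal_pdf.
rewrite !dens//; last by move=> x; exact: expe2_ge0.
pose c := expR (a ^+ 2 / s ^+ 2).
have -> : (c / u)%:E = \int[mu]_x ((c / u)%:E * (normal_pdf (2 * a) s x)%:E).
  rewrite ge0_integralZl//; last 2 first.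
  - exact: mpdf.
  - by rewrite lee_fin divr_ge0 ?ltW ?expR_gt0.
  by rewrite integral_normal_pdf mule1.
have mA : measurable_fun setT (fun x : measurableTypeR R =>
    g x * (normal_pdf a s x)%:E).
  by apply: emeasurable_funM; [exact: mg|exact: mpdf].
have mB : measurable_fun setT (fun x : measurableTypeR R =>
    g x ^+ 2 * (normal_pdf 0 s x)%:E).
  by apply: emeasurable_funM; [exact: mg2|exact: mpdf].
have mC : measurable_fun setT (fun x : measurableTypeR R =>
    (normal_pdf (2 * a) s x)%:E) by exact: mpdf.
have A0 x : 0 <= g x * (normal_pdf a s x)%:E by exact: mule_ge0.
have B0 x : 0 <= g x ^+ 2 * (normal_pdf 0 s x)%:E.
  by rewrite mule_ge0// expe2_ge0.
have u_ge0 : 0 <= u%:E by rewrite lee_fin ltW.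
have cu_ge0 : 0 <= (c / u)%:E by rewrite lee_fin divr_ge0 ?ltW ?expR_gt0.
rewrite -ge0_integralZl// -ge0_integralZl// -ge0_integralD//; last 4 first.
- by move=> x _; exact: mule_ge0.
- exact: measurable_funeM.
- by move=> x _; exact: mule_ge0.
- exact: measurable_funeM.
apply: ge0_le_integral => //.
- by move=> x _; exact: mule_ge0.
- exact: measurable_funeM.
- by apply: emeasurable_funD; exact: measurable_funeM.
move=> x _; have := g0 x.
have p0 := normal_pdf_gt0 0 x s0; have p2 := normal_pdf_gt0 (2 * a) x s0.
have := sqr_normal_pdf a x s0; rewrite -/c.
have c0 : (0 < c)%R by exact: expR_gt0.
set p := normal_pdf 0 s x in p0 *; set q := normal_pdf (2 * a) s x in p2 *.
set r := normal_pdf a s x => r2.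
case: (g x) => [y| |//]; last first.
  move=> _; rewrite [X in _ <= X](_ : _ = +oo) ?leey// expe2 mulyy.
  by rewrite gt0_mulye ?lte_fin// gt0_muley ?lte_fin// -EFinM addye.
rewrite lee_fin -EFin_expe -!EFinM -EFinD lee_fin => y0.
have r0 : (0 < r)%R by exact: normal_pdf_gt0.
(* with a common denominator, the bound is the square of a difference *)
have -> : (u * (y ^+ 2 * p) + c / u * q = ((u * y * p) ^+ 2 + r ^+ 2) / (u *
  p))%R.
  by rewrite r2; field; rewrite !gt_eqF.
rewrite ler_pdivlMr ?mulr_gt0//.
have := sqr_ge0 (u * y * p - r)%R.
by nra.
Qed.

Definition translate (a x : R) : R := (x + a)%R.

Lemma measurable_translate (a : R) :
  measurable_fun [set: measurableTypeR R]
    (translate a : measurableTypeR R -> measurableTypeR R).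
Proof. exact: measurable_funD. Qed.

HB.instance Definition _ (a : R) := isMeasurableFun.Build _ _
  (measurableTypeR R) (measurableTypeR R) (translate a) (measurable_translate
    a).

Lemma lebesgue_measure_translate (a : R) (B : set R) : measurable B ->
  mu (translate a @^-1` B) = mu B.
Proof.
move=> mB; symmetry.
apply: (@lebesgue_measure_unique _
  (measure_function_pushforward__canonical__measure_function_Measure mu
     (measurable_translate a)) _ B) => // X /ocitvP[->|[[u v] /= uv ->]] /=.
  by rewrite measure0 /pushforward preimage_set0 measure0.
rewrite /pushforward.
have -> : translate a @^-1` `]u, v] = `](u - a)%R, (v - a)%R]%classic.
  by apply/seteqP; split => x /=; rewrite !in_itv/= /translate ltrBlDr lerBrDr.
rewrite !lebesgue_measure_itv/= !lte_fin uv ltrD2r uv -!EFinB.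
by congr EFin; ring.
Qed.

Lemma normal_prob_translate (a s : R) (B : set R) : s != 0%R -> measurable B ->
  normal_prob 0 s (translate a @^-1` B) = normal_prob a s B.
Proof.
move=> s0 mB; rewrite /normal_prob.
have pdfE : (fun x => (normal_pdf 0 s x)%:E) =
    (fun y => (normal_pdf a s y)%:E) \o translate a.
  by apply/funext => x; rewrite /= !normal_pdfE// /normal_fun /translate subr0
    addrK.
rewrite pdfE.
rewrite -(@ge0_integral_pushforward _ _ (measurableTypeR R) (measurableTypeR R)
  R
  (translate a) (measurable_translate a) mu B (fun y => (normal_pdf a s
    y)%:E))//.
- apply: eq_measure_integral => [|? A mA _]; first exact: measurable_translate.
  exact: lebesgue_measure_translate.
- by apply/measurable_funTS/measurable_EFinP; exact: measurable_normal_pdf.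
- by move=> y _; rewrite lee_fin normal_pdf_ge0.
Qed.

End gaussian.

(** * Approximation by a generating algebra *)

Section algebra_approximation.
Context d (T : measurableType d) (R : realType).
Variables (mu : {measure set T -> \bar R}) (G : set (set T)).
Hypotheses (mufin : forall A, measurable A -> mu A \is a fin_num)
  (G0 : G set0) (GC : forall A, G A -> G (~` A))
  (GU : forall A B, G A -> G B -> G (A `|` B)) (mG : G `<=` measurable).
Local Open Scope ereal_scope.

Let measurableY (A B : set T) : measurable A -> measurable B -> measurable (A
  `+` B).
Proof. by move=> mA mB; apply: measurableU; exact: measurableD. Qed.

Let approx (A : set T) := measurable A /\
  forall e : R, (0 < e)%R -> exists2 B, G B & mu (A `+` B) <= e%:E.

Let approxU A B : approx A -> approx B -> approx (A `|` B).
Proof.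
move=> [mA aA] [mB aB]; split; first exact: measurableU.
move=> e e0; have e20 : (0 < e / 2)%R by rewrite divr_gt0.
have [A' GA' muA] := aA _ e20; have [B' GB' muB] := aB _ e20.
have mA' := mG GA'; have mB' := mG GB'.
exists (A' `|` B'); first exact: GU.
rewrite [e]splitr EFinD; apply: le_trans (leeD muA muB).
apply: (le_trans _ (@measureU2 _ _ _ mu _ _ (measurableY mA mA') (measurableY
  mB mB'))).
apply: le_measure; rewrite ?inE.
- by apply: measurableY; exact: measurableU.
- by apply: measurableU; exact: measurableY.
rewrite /setY => x /=; tauto.
Qed.

(** The sets that can be approximated form a sigma-algebra: a countable union is
    first truncated, by continuity of the measure from above, and then
    approximated piece by piece. *)
Lemma algebra_approximation A : <<s G >> A ->
  forall e : R, (0 < e)%R -> exists2 B, G B & mu (A `+` B) <= e%:E.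
Proof.
suff sub : <<s G >> `<=` approx by move=> /sub[].
apply: smallest_sub; last first.
  move=> B GB; split; first exact: mG.
  by move=> e e0; exists B => //; rewrite setYK measure0 lee_fin ltW.
split.
- split; first exact: measurable0.
  by move=> e e0; exists set0 => //; rewrite setYK measure0 lee_fin ltW.
- move=> B [mB aB]; split; first exact: measurableD.
  move=> e e0; have [B' GB' muB] := aB _ e0; exists (~` B'); first exact: GC.
  apply: le_trans muB; rewrite le_eqVlt; apply/orP; left; apply/eqP;
    congr (mu _).
  rewrite setTD /setY; apply/seteqP; split => x /=;
    by have := pselect (B x); have := pselect (B' x); tauto.
move=> F aF.
have mF i : measurable (F i) by case: (aF i).
have mUF : measurable (\bigcup_i F i) by exact: bigcup_measurable.
split=> // e e0; have e20 : (0 < e / 2)%R by rewrite divr_gt0.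
pose U n := \big[setU/set0]_(i < n) F i.
have aU n : approx (U n).
  elim: n => [|n IH]; last by rewrite /U big_ord_recr; exact: approxU.
  rewrite /U big_ord0; split; first exact: measurable0.
  by move=> e' e'0; exists set0 => //; rewrite setYK measure0 lee_fin ltW.
have mU n : measurable (U n) by case: (aU n).
have cvg0 : mu (\bigcup_i F i `\` U n) @[n --> \oo] --> 0.
  have <- : mu (\bigcap_n (\bigcup_i F i `\` U n)) = 0.
    rewrite (_ : \bigcap_n _ = set0) ?measure0//.
    rewrite -subset0 => x Ux; have [[i _ Fix] _] := Ux 0%N I.
    have [_] := Ux i.+1 I; apply.
    by rewrite /U big_ord_recr; right.
  apply: nonincreasing_cvg_mu => //.
  - by rewrite ltey_eq mufin//; exact: measurableD.
  - by move=> n; exact: measurableD.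
  - by apply: bigcap_measurable => // n _; exact: measurableD.
  - move=> m n mn; apply/subsetPset => x [Fx Ux]; split => // Umx; apply: Ux.
    by apply: subset_bigsetU Umx.
have [n muU] : exists n, mu (\bigcup_i F i `\` U n) <= (e / 2)%:E.
  have /fine_cvgP[_ /cvgrPdist_le/(_ _ e20)[N _ HN]] := cvg0.
  exists N; have := HN N (leqnn N); rewrite /= sub0r normrN ger0_norm
    ?fine_ge0//.
  by rewrite -lee_fin fineK// mufin//; exact: measurableD.
have [_ /(_ _ e20)[B GB muB]] := aU n; exists B => //.
have mB := mG GB.
rewrite [e]splitr EFinD; apply: le_trans (leeD muU muB).
apply: (le_trans _ (@measureU2 _ _ _ mu _ _ (measurableD mUF (mU n))
  (measurableY (mU n) mB))).
apply: le_measure; rewrite ?inE.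
- exact: measurableY.
- by apply: measurableU; [exact: measurableD|exact: measurableY].
have UF : U n `<=` \bigcup_i F i by exact: bigsetU_bigcup.
rewrite /setY => x /= [[Fx nBx]|[Bx nFx]].
  by have [Ux|Ux] := pselect (U n x); [right; left|left].
by right; right; split => // /UF.
Qed.

End algebra_approximation.

Section chi2_le_extension.
Import HBNNSimple.
Context d (T : measurableType d) (R : realType).

(** The sets need not be disjoint: approximating disjoint sets by members of an
    algebra does not keep them disjoint. *)
Definition step_fun m (a : 'I_m -> R) (A : 'I_m -> set T) (x : T) : R :=
  \sum_(i < m) a i * \1_(A i) x.

Lemma step_fun_ge0 m (a : 'I_m -> R) (A : 'I_m -> set T) x :
  (forall i, 0 <= a i) -> 0 <= step_fun a A x.
Proof. by move=> a0; apply: sumr_ge0 => i _; rewrite mulr_ge0. Qed.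

Lemma integral_step_fun (P : probability T R) m (a : 'I_m -> R)
    (A : 'I_m -> set T) :
  (forall i, 0 <= a i) -> (forall i, measurable (A i)) ->
  (\int[P]_x (step_fun a A x)%:E = (\sum_(i < m) a i * fine (P (A i)))%:E)%E.
Proof.
move=> a0 mA; rewrite -sumEFin.
under eq_integral do rewrite -sumEFin.
rewrite ge0_integral_sum//; last 2 first.
- move=> i; apply/measurable_EFinP; apply: measurable_funM => //.
- by move=> i x _; rewrite lee_fin mulr_ge0.
apply: eq_bigr => i _; under eq_integral do rewrite EFinM.
rewrite ge0_integralZl//; last 2 first.
- exact/measurable_EFinP/measurable_indic.
- by rewrite lee_fin.
by rewrite integral_indic// setIT EFinM fineK// fin_num_measure.
Qed.

Lemma integral_sqr_step_fun (P : probability T R) m (a : 'I_m -> R)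
    (A : 'I_m -> set T) :
  (forall i, 0 <= a i) -> (forall i, measurable (A i)) ->
  (\int[P]_x ((step_fun a A x)%:E ^+ 2) =
   (\sum_(i < m) \sum_(j < m) a i * a j * fine (P (A i `&` A j)))%:E)%E.
Proof.
move=> a0 mA.
transitivity (\int[P]_x \sum_(i < m)
    (step_fun (fun j => a i * a j) (fun j => A i `&` A j) x)%:E)%E.
  apply: eq_integral => x _; rewrite sumEFin -EFin_expe expr2; congr EFin.
  rewrite big_distrlr/=; apply: eq_bigr => i _; apply: eq_bigr => j _.
  by rewrite indicI/=; ring.
rewrite ge0_integral_sum//; last 2 first.
- move=> i; apply/measurable_EFinP; apply: measurable_sum => j.
  by apply: measurable_funM => //; apply: measurable_indic; exact: measurableI.
- by move=> i x _; rewrite lee_fin step_fun_ge0// => j; exact: mulr_ge0.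
rewrite -sumEFin; apply: eq_bigr => i _; rewrite integral_step_fun//.
  by move=> j; exact: mulr_ge0.
by move=> j; exact: measurableI.
Qed.

Section quadratic_form.
Variables (P Q : probability T R) (c : R).
Notation p A := (fine (P A)).
Notation q A := (fine (Q A)).

(* This linear form of the inequality for a step function involves the sets only
   through the masses of their intersections, so it is continuous in the sets. *)
Let form m (a : 'I_m -> R) (A : 'I_m -> set T) :=
  2 * (\sum_(i < m) a i * p (A i)) <=
  c + \sum_(i < m) \sum_(j < m) a i * a j * q (A i `&` A j).

Let le_fine (mu : probability T R) A B C : measurable A -> measurable B ->
  measurable C -> A `<=` B `|` C -> fine (mu A) <= fine (mu B) + fine (mu C).
Proof.
move=> mA mB mC sub; rewrite -lee_fin EFinD !fineK ?fin_num_measure//.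
apply: le_trans (@measureU2 _ _ _ mu _ _ mB mC).
by apply: le_measure; rewrite ?inE//; exact: measurableU.
Qed.

(** It suffices to test step functions over a generating algebra: measurable sets
    are approximated by members of the algebra simultaneously for [P] and [Q], and
    nonnegative functions by simple functions from below. *)
Lemma chi2_le_algebra (G : set (set T)) :
  0 < c -> G set0 -> (forall A, G A -> G (~` A)) ->
  (forall A B, G A -> G B -> G (A `|` B)) -> measurable = <<s G >> ->
  (forall m (a : 'I_m -> R) (A : 'I_m -> set T),
    (forall i, 0 <= a i) -> (forall i, G (A i)) ->
    ((\int[P]_x (step_fun a A x)%:E) ^+ 2 <=
     c%:E * \int[Q]_x ((step_fun a A x)%:E ^+ 2))%E) ->
  chi2_le P Q c.
Proof.
move=> c0 G0 GC GU measE PQG.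
have mG : G `<=` measurable by rewrite measE; exact: sub_gen_smallest.
have formG m (a : 'I_m -> R) (A : 'I_m -> set T) :
    (forall i, 0 <= a i) -> (forall i, G (A i)) -> form a A.
  move=> a0 GA; have := PQG m a A a0 GA.
  rewrite integral_step_fun//; last by move=> i; exact: mG.
  rewrite integral_sqr_step_fun//; last by move=> i; exact: mG.
  rewrite -EFin_expe -EFinM lee_fin /form.
  set I := \sum_(i < m) a i * p (A i); set S := \sum_(i < m) \sum_(j < m) _.
  have S0 : 0 <= S.
    by apply: sumr_ge0 => i _; apply: sumr_ge0 => j _;
      rewrite !mulr_ge0// fine_ge0.
  move=> IS; rewrite leNgt; apply/negP => lt.
  have : 0 < (2 * I - (c + S)) * (2 * I + (c + S)) by apply: mulr_gt0; lra.
  by have := sqr_ge0 (c - S); nra.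
have formT m (a : 'I_m -> R) (A : 'I_m -> set T) :
    (forall i, 0 <= a i) -> (forall i, measurable (A i)) -> form a A.
  move=> a0 mA; apply/ler_addgt0Pr => e e0.
  pose S := \sum_(i < m) a i; have S0 : 0 <= S by exact: sumr_ge0.
  (* [K * dl] bounds the total error when each set is moved by [dl] *)
  pose K := 2 * S + 2 * S ^+ 2 + 1.
  have K0 : 0 < K by rewrite /K ltr_wpDl// addr_ge0 ?mulr_ge0// sqr_ge0.
  pose dl := e / K; have dl0 : 0 < dl by rewrite divr_gt0.
  have approx i : exists B, [/\ G B, p (A i `+` B) <= dl & q (A i `+` B) <= dl].
    have PQfin C : measurable C -> measure_add P Q C \is a fin_num.
      by move=> mC; rewrite measure_addE fin_numD !fin_num_measure.
    have := mA i; rewrite measE => sA.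
    have [B GB] := algebra_approximation PQfin G0 GC GU mG sA dl0.
    have mAB : measurable (A i `+` B).
      by have mB := mG _ GB; apply: measurableU; exact: measurableD.
    rewrite /= -/(measure_add P Q _) measure_addE => PQB; exists B.
    split=> //; rewrite -lee_fin fineK ?fin_num_measure//;
      by apply: le_trans PQB; rewrite ?leeDl ?leeDr.
  have [B HB] := choice approx.
  have GB i : G (B i) by case: (HB i).
  have mB i : measurable (B i) by exact: mG.
  have mAB i : measurable (A i `+` B i) by apply: measurableU;
    exact: measurableD.
  have pAB i : p (A i) <= p (B i) + dl.
    have [_ pd _] := HB i; apply: (@le_trans _ _ (p (B i) + p (A i `+` B i)));
      last by rewrite lerD2l.
    apply: le_fine => // x Ax; have [Bx|nBx] := pselect (B i x); first by left.
    by right; left.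
  have qAB i j : q (B i `&` B j) <= q (A i `&` A j) + 2 * dl.
    have [_ _ qi] := HB i; have [_ _ qj] := HB j.
    have mUAB : measurable ((A i `+` B i) `|` (A j `+` B j)) by exact:
      measurableU.
    apply: (@le_trans _ _ (q (A i `&` A j) + q ((A i `+` B i) `|` (A j `+` B
      j)))).
      apply: le_fine => //; [exact: measurableI|exact: measurableI|].
      move=> x [Bi Bj]; have [Ai|nAi] := pselect (A i x); last by right; left;
        right.
      by have [Aj|nAj] := pselect (A j x); [left|right; right; right].
    rewrite lerD2l; apply: le_trans (@le_fine Q _ _ _ _ _ _ (@subset_refl _ _))
      _ => //.
    by move: qi qj; lra.
  have step1 : 2 * (\sum_(i < m) a i * p (A i)) <=
      2 * (\sum_(i < m) a i * p (B i)) + 2 * S * dl.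
    rewrite -mulrA -mulrDr ler_pM2l// mulr_suml -big_split/=.
    by apply: ler_sum => i _; rewrite -mulrDr ler_wpM2l.
  have step2 : \sum_(i < m) \sum_(j < m) a i * a j * q (B i `&` B j) <=
      \sum_(i < m) \sum_(j < m) a i * a j * q (A i `&` A j) + S ^+ 2 * (2 * dl).
    rewrite expr2 /S big_distrlr/= mulr_suml -big_split/=.
    apply: ler_sum => i _; rewrite mulr_suml -big_split/=.
    by apply: ler_sum => j _; rewrite -mulrDr ler_wpM2l ?mulr_ge0.
  have := formG m a B a0 GB; rewrite /form => step3.
  have -> : e = K * dl by rewrite /dl mulrC divfK// gt_eqF.
  rewrite /K; move: step1 step2 step3; nra.
move=> g mg g0; apply: sqr_le_of_linear => //.
- exact: integral_ge0.
- by apply: integral_ge0 => x _; exact: expe2_ge0.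
move=> u u0; set B := (u%:E * _ + _)%E.
suff IB : (\int[P]_x g x <= 2^-1%:E * B)%E.
  have := lee_wpmul2l (_ : 0 <= 2%:E)%E IB; rewrite lee_fin => /(_ (ler0n _ _)).
  by rewrite muleA -EFinM mulfV// mul1e.
rewrite ge0_integralTE//; apply: ge_ereal_sup => _ [h hg <-].
rewrite -integralT_nnsfun.
pose s := finmap.enum_fset (fset_set (range h)).
pose a (i : 'I_(size s)) := s`_i; pose A i := h @^-1` [set a i].
have hE x : h x = step_fun a A x by exact: fimfunEord.
have a0 i : 0 <= a i.
  have : a i \in s by exact: mem_nth.
  by rewrite in_fset_set// inE => -[x _ <-].
have mA i : measurable (A i) by exact: measurable_sfunP.
have : (\int[Q]_x ((step_fun a A x)%:E ^+ 2) <= \int[Q]_x (g x ^+ 2))%E.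
  apply: ge0_le_integral => //.
  - by move=> x _; apply: expe2_ge0; rewrite lee_fin -hE.
  - apply: measurable_fun_expe2; apply/measurable_EFinP.
    by apply: (eq_measurable_fun h) => // x _; rewrite hE.
  - exact: measurable_fun_expe2.
  - by move=> x _; rewrite -hE; apply: lee_sqr; rewrite ?lee_fin.
rewrite integral_sqr_step_fun// => QhB.
under eq_integral do rewrite hE.
rewrite integral_step_fun//.
have := formT _ (fun i => u * a i) A (fun i => mulr_ge0 (ltW u0) (a0 i)) mA.
rewrite /form; under eq_bigr do rewrite -mulrA.
rewrite -mulr_sumr.
under [X in _ <= _ + X]eq_bigr => i _.
  under eq_bigr => j _ do rewrite mulrACA -expr2 -[u ^+ 2 * _ * _]mulrA.
  rewrite -mulr_sumr; over.
rewrite -mulr_sumr.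
set I := \sum_(i < _) _; set S := \sum_(i < _) _ in QhB *.
move=> le.
have {}le : I <= 2^-1 * (u * S + c / u).
  rewrite -(ler_pM2l u0) -(@ler_pM2l _ 2)//.
  by apply: le_trans le _; rewrite [leRHS](_ : _ = c + u ^+ 2 * S)//; field;
    rewrite gt_eqF.
apply: (@le_trans _ _ (2^-1 * (u * S + c / u))%:E); first by rewrite lee_fin.
rewrite EFinM lee_wpmul2l ?lee_fin// /B EFinD EFinM leeD2r//.
by rewrite lee_wpmul2l// lee_fin ltW.
Qed.
End quadratic_form.

End chi2_le_extension.

(** * Cylinder sets of the path space *)

Section cylinders.
Context (R : realType).
Notation time := (time R).
Notation cpath := (cpath R).

(** Events that depend on the path at the finitely many times [s] only, as a
    sigma-algebra: unions over [s] are then visibly directed. *)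
Definition cylinders (s : seq time) : set (set cpath) :=
  <<s \bigcup_(t in [set` s])
        preimage_set_system [set: cpath] (path_eval t) measurable >>.

Lemma sub_cylinders (s s' : seq time) : {subset s <= s'} ->
  cylinders s `<=` cylinders s'.
Proof.
move=> ss'; apply: smallest_sub; first exact: smallest_sigma_algebra.
by move=> A [t st tA]; apply: sub_sigma_algebra; exists t => //; exact: ss'.
Qed.

Let time0_subproof : (0 : R) \in (`[0, 1]%classic : set R).
Proof. by rewrite inE/= in_itv/= lexx ler01. Qed.

Definition time0 : time := exist _ 0 time0_subproof.

Lemma val_time_itv (t : time) : 0 <= \val t <= 1.
Proof. by have := valP t; rewrite inE/= in_itv. Qed.

(** Independence of increments is only available along increasing times starting
    at 0, so arbitrary times are sorted and 0 is added. *)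
Lemma exists_grid (s : seq time) : exists (k : nat) (t : nat -> time),
  [/\ \val (t 0%N) = 0,
      forall i, (i < k)%N -> \val (t i) < \val (t i.+1)
    & forall u, u \in s -> exists2 i, (i <= k)%N & u = t i].
Proof.
pose r := sort <=%R (undup (0 :: map \val s)).
have r_sorted : sorted <%R r by rewrite sort_lt_sorted undup_uniq.
have memr x : (x \in r) = (x \in (0 :: map \val s)).
  by rewrite mem_sort mem_undup.
have r01 x : x \in r -> x \in (`[0, 1]%classic : set R).
  rewrite memr inE => /orP[/eqP->|/mapP[u _ ->]]; last exact: valP.
  exact: valP time0.
have r0 : (0 < size r)%N.
  have : 0 \in r by rewrite memr mem_head.
  by case: (r).
exists (size r).-1, (fun i => insubd time0 (nth 0 r i)).
have val_t i : (i < size r)%N -> \val (insubd time0 (nth 0 r i)) = nth 0 r i.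
  by move=> ir; apply: insubdK; apply: r01; exact: mem_nth.
split.
- rewrite val_t//; apply/eqP; rewrite eq_le; apply/andP; split; last first.
    by have := r01 _ (mem_nth 0 r0); rewrite inE/= in_itv/= => /andP[].
  have : 0 \in r by rewrite memr mem_head.
  move=> /(nthP 0)[j jr rj]; suff : nth 0 r 0 <= nth 0 r j by rewrite rj.
  by rewrite (lt_sorted_leq_nth 0 r_sorted).
- move=> i; rewrite -ltnS prednK// => ir.
  have ir' : (i < size r)%N by exact: ltnW.
  by rewrite !val_t// (lt_sorted_ltn_nth 0 r_sorted).
- move=> u us.
  have : \val u \in r by rewrite memr inE map_f ?orbT.
  move=> /(nthP 0)[i ir ui]; exists i; first by rewrite -ltnS prednK.
  by apply: val_inj; rewrite val_t.
Qed.

(** The initial value comes first, so that the path on the grid can be recovered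
    by partial sums. *)
Definition grid_increment (t : nat -> time) (w : cpath) (i : nat) : R :=
  if i is j.+1 then w (t j.+1) - w (t j) else w (t 0%N).

Definition grid_increments (t : nat -> time) (k : nat) (w : cpath) :
    k.+1.-tuple (measurableTypeR R) := [tuple grid_increment t w i | i < k.+1].

Lemma path_eval_sum_increment (t : nat -> time) (w : cpath) j :
  path_eval (t j) w = \sum_(i < j.+1) grid_increment t w i.
Proof.
elim: j => [|j IH]; first by rewrite big_ord1.
by rewrite big_ord_recr/= -IH /path_eval addrC subrK.
Qed.

Lemma measurable_grid_increments (t : nat -> time) k :
  measurable_fun [set: cpath] (grid_increments t k).
Proof.
apply/measurable_fun_tnthP => i.
rewrite (_ : _ \o _ = fun w => grid_increment t w i); last first.
  by apply/funext => w /=; rewrite tnth_mktuple.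
case: i => -[_|j _]/=; first exact: measurable_path_eval.
by apply: measurable_funB; exact: measurable_path_eval.
Qed.

HB.instance Definition _ (t : nat -> time) k := isMeasurableFun.Build _ _ _ _
  (grid_increments t k) (@measurable_grid_increments t k).

(** The preimages of measurable sets under the increments form a sigma-algebra,
    and it contains the events about one time of the grid because the value there
    is a partial sum of increments. *)
Lemma cylinders_grid (s : seq time) (t : nat -> time) k :
  (forall u, u \in s -> exists2 i, (i <= k)%N & u = t i) ->
  forall A, cylinders s A ->
    exists2 B, measurable B & A = grid_increments t k @^-1` B.
Proof.
move=> st A sA.
suff [B mB <-] : preimage_set_system setT (grid_increments t k) measurable A.
  by exists B => //; rewrite setTI.
move: A sA; apply: smallest_sub.
  by apply: sigma_algebra_preimage; exact: sigma_algebra_measurable.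
move=> _ [u /st[j jk ->] [C mC <-]].
pose sum_upto (y : k.+1.-tuple (measurableTypeR R)) : R := \sum_(i < k.+1 | (i
  <= j)%N) tnth y i.
exists (sum_upto @^-1` C).
  have msum : measurable_fun setT sum_upto.
    rewrite /sum_upto; under eq_fun do rewrite -big_filter.
    by apply: measurable_sum => i; exact: measurable_tnth.
  by rewrite -[_ @^-1` _]setTI; exact: msum.
have evalE w : path_eval (t j) w = sum_upto (grid_increments t k w).
  rewrite path_eval_sum_increment (big_ord_widen k.+1 (grid_increment t w))//.
  by apply: eq_bigr => i _; rewrite tnth_mktuple.
by rewrite !setTI; apply/seteqP; split => w; rewrite /= evalE.
Qed.

End cylinders.

(** * Increments of the drift *)

Section drift_increments.
Context (R : realType).
Notation mu := (@lebesgue_measure R).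

Let mI (i : interval R) : measurable ([set` i] : set (measurableTypeR R)).
Proof. exact: measurable_itv. Qed.

Variable f : R -> R.
Hypotheses (mf : measurable_fun (`[0, 1]%classic : set R) f)
  (f2_int : mu.-integrable `[0, 1] (fun x => (f x ^+ 2)%:E)).

Lemma integrable_cst_itv (i : interval R) (k : R) : (mu [set` i] < +oo)%E ->
  mu.-integrable [set` i] (EFin \o cst k).
Proof.
move=> fin; apply/integrableP; split => //;
  first exact/measurable_EFinP/measurable_cst.
by rewrite /= integral_cst//= lte_mul_pinfty// ?lee_fin.
Qed.

Lemma integrable_of_sqr : mu.-integrable `[0, 1] (EFin \o f).
Proof.
have int1 : mu.-integrable `[0, 1] (EFin \o cst (1 : R)).
  by apply: integrable_cst_itv; rewrite lebesgue_measure_itv/= lte_fin ltr01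
    -EFinB ltry.
have int := integrableD (mI _) int1 f2_int.
apply: (le_integrable _ _ _ int) => //.
- exact/measurable_EFinP.
- move=> x _; rewrite /= lee_fin [leRHS]ger0_norm ?addr_ge0 ?sqr_ge0//.
  by rewrite ler_norml; apply/andP; split; have := sqr_ge0 (f x - 1);
    have := sqr_ge0 (f x + 1); nra.
Qed.

(** Cauchy-Schwarz on one cell of the grid.  The right-hand side is written as a
    difference so that it telescopes over the grid. *)
Lemma sqr_increment_le (u v : R) : 0 <= u -> u < v -> v <= 1 ->
  (\int[mu]_(x in `[0, v]) f x - \int[mu]_(x in `[0, u]) f x) ^+ 2 / (v - u) <=
  \int[mu]_(x in `[0, v]) (f x ^+ 2) - \int[mu]_(x in `[0, u]) (f x ^+ 2).
Proof.
move=> u0 uv v1.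
have sub0 : `[0, v] `<=` (`[0, 1] : set R).
  by apply: subset_itvl; rewrite bnd_simp.
have sub : `]u, v] `<=` (`[0, 1] : set R).
  by apply: subset_itv; rewrite bnd_simp.
have intf := integrable_of_sqr.
have intf0 := integrableS (mI _) (mI _) sub0 intf.
have intf20 := integrableS (mI _) (mI _) sub0 f2_int.
have cellE (g : R -> R) : mu.-integrable `[0, v] (EFin \o g) ->
    \int[mu]_(x in `[0, v]) g x - \int[mu]_(x in `[0, u]) g x =
    \int[mu]_(x in `]u, v]) g x.
  by move=> g_int; apply: Rintegral_itvB; rewrite ?bnd_simp// ltW.
rewrite !cellE//.
have cell_int := integrableS (mI _) (mI _) sub intf.
have cell_int2 := integrableS (mI _) (mI _) sub f2_int.
have vu : 0 < v - u by rewrite subr_gt0.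
set a := \int[mu]_(x in `]u, v]) f x.
set E := \int[mu]_(x in `]u, v]) (f x ^+ 2).
(* the mean of [f] on the cell *)
pose m := a / (v - u).
have mD : mu [set` `]u, v]] = (v - u)%:E by rewrite lebesgue_measure_itv/=
  lte_fin uv.
have m2_int : mu.-integrable `]u, v] (EFin \o cst (m ^+ 2)).
  by apply: integrable_cst_itv; rewrite mD ltry.
have mf_int : mu.-integrable `]u, v] (EFin \o (fun x => 2 * m * f x)).
  exact: (integrableZl (mI _) (2 * m) cell_int).
have : 0 <= \int[mu]_(x in `]u, v]) ((f x ^+ 2 - 2 * m * f x) + m ^+ 2).
  by apply: Rintegral_ge0 => x _; have := sqr_ge0 (f x - m); nra.
rewrite RintegralD//; last first.
  exact: (integrableB (mI _) cell_int2 mf_int).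
rewrite RintegralB// RintegralZl// Rintegral_cst//.
rewrite (_ : fine _ = v - u) -/a -/E; last exact: (congr1 fine mD).
have -> : a ^+ 2 / (v - u) = 2 * m * a - m ^+ 2 * (v - u).
  by rewrite /m; field; rewrite gt_eqF.
by lra.
Qed.

End drift_increments.

(** * Second moments of the drifted Wiener laws *)

Section cameron_martin.
Context (R : realType) d (Omega : measurableType d) (Pr : probability Omega R).
Variable W : {RV Pr >-> cpath R}.
Hypothesis WW : standard_wiener W.
Notation mu := (@lebesgue_measure R).
Notation time := (time R).
Notation R' := (measurableTypeR R).

Section increment_law.
Variable f : R -> R.
Hypothesis f_int : mu.-integrable `[0, 1] (EFin \o f).
Variables (k : nat) (t : nat -> time).
Hypotheses (t0 : \val (t 0%N) = 0)
  (t_lt : forall i, (i < k)%N -> \val (t i) < \val (t i.+1)).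

(** Under the law of signal plus noise, the path starts at 0 and its increments
    are independent Gaussian variables, shifted by the increments of the drift. *)
Definition increment_law (i : nat) : probability R' R :=
  if i is j.+1 then
    normal_prob (primitive f (t j.+1) - primitive f (t j))
      (Num.sqrt (\val (t j.+1) - \val (t j)))
  else dirac (0 : R').

(** Both sides are compared on boxes: the signal moves the sides of the box and
    the initial value is almost surely 0. *)
Lemma increments_law A : measurable A ->
  distribution (signal_law W f) (grid_increments t k) A =
  product_law increment_law k.+1 A.
Proof.
have [W0 W_normal W_indep] := WW.
apply: eq_measure_box => B mB; rewrite product_law_box// big_ord_recl.
have mW u : measurable_fun setT (fun w => W w u : R).
  apply: (measurableT_comp (measurable_path_eval u)); exact: measurable_funP.
pose a j := primitive f (t j.+1) - primitive f (t j).
pose E0 := [set w | B 0%N (W w (t 0%N))].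
pose E j := increment W (t j) (t j.+1) @^-1` (translate (a j) @^-1` B j.+1).
have mtB j : measurable (translate (a j) @^-1` B j.+1).
  by rewrite -[X in measurable X]setTI; exact: measurable_translate.
have mE j : measurable (E j).
  rewrite -[E j]setTI; have : measurable_fun setT (increment W (t j) (t j.+1)).
    by apply: measurable_funB; exact: mW.
  by apply => //; exact: mtB.
have mE0 : measurable E0 by have := mW (t 0%N) measurableT (B 0%N) (mB 0%N);
  rewrite setTI.
pose N := [set w | W w (t 0%N) != 0].
have mN : measurable N.
  rewrite (_ : N = ~` ((fun w => W w (t 0%N)) @^-1` [set 0])).
    apply: measurableC; rewrite -[X in measurable X]setTI; exact: mW.
  by apply/seteqP; split => w /= /eqP.
have PN : Pr N = 0%E.
  apply: measure_negligible => //; move: (W0 _ t0).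
  by apply: negligibleS => w /= /eqP.
have sE w u : signal f W w u = primitive f u + W w u.
  by rewrite -(driftE f_int).
have sE0 w : signal f W w (t 0%N) = W w (t 0%N).
  by rewrite sE /primitive t0 set_itv1 Rintegral_set1 add0r.
have sE1 w j : signal f W w (t j.+1) - signal f W w (t j) =
    translate (a j) (increment W (t j) (t j.+1) w).
  by rewrite !sE /increment /translate /a; ring.
transitivity (Pr (E0 `&` \bigcap_(j in `I_k) E j)).
  congr (Pr _); apply/seteqP; split => w.
    move=> Hw; split; first by have := Hw ord0; rewrite tnth_mktuple/= sE0.
    move=> j /= jk; have := Hw (Ordinal (jk : (j.+1 < k.+1)%N)).
    by rewrite tnth_mktuple/= sE1.
  move=> [E0w Ew] i; rewrite tnth_mktuple.
  case: i => -[i0|j jk] /=; first by rewrite sE0.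
  by rewrite sE1; exact: Ew.
have mEk : measurable (\bigcap_(j in `I_k) E j).
  by apply: fin_bigcap_measurable => // j _; exact: mE.
transitivity ((\1_(B 0%N) (0%R : R))%:E * Pr (\bigcap_(j in `I_k) E j))%E.
  rewrite indicE; case: (boolP (_ \in _)) => B0.
    rewrite mul1e; apply/eqP; rewrite eq_le; apply/andP; split.
      by apply: le_measure; rewrite ?inE//; exact: measurableI.
    have mI := measurableI _ _ mE0 mEk.
    rewrite -[leRHS]adde0 -PN; apply: (le_trans _ (@measureU2 _ _ _ Pr _ _ mI
      mN)).
    apply: le_measure; rewrite ?inE//; first exact: measurableU.
    move=> w Ew; have [W0w|W0w] := eqVneq (W w (t 0%N)) 0; last by right.
    by left; split => //; rewrite /E0/= W0w; exact: set_mem B0.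
  rewrite mul0e; apply/eqP; rewrite -measure_le0 -PN.
  apply: le_measure; rewrite ?inE//; first exact: measurableI.
  move=> w [E0w _]; apply/eqP => W0w; move: B0; rewrite notin_setE; apply.
  by move: E0w; rewrite /E0/= W0w.
rewrite /= diracE; congr (_ * _)%E.
rewrite W_indep//.
apply: eq_bigr => j _; rewrite W_normal//; last exact: t_lt.
have s0 : Num.sqrt (\val (t j.+1) - \val (t j)) != 0.
  by rewrite sqrtr_eq0 -ltNge subr_gt0 t_lt.
exact: (normal_prob_translate (a j) s0 (mB j.+1)).
Qed.

End increment_law.

(** The product of the one-dimensional constants is the exponential of a sum of
    terms (drift increment)^2 / (time step), which Cauchy-Schwarz on the cells
    bounds by the energy of [f], uniformly over grids. *)
Lemma chi2_le_cylinder (f : R -> R) (k : nat) (t : nat -> time) :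
  measurable_fun (`[0, 1]%classic : set R) f ->
  mu.-integrable `[0, 1] (fun x => (f x ^+ 2)%:E) ->
  \val (t 0%N) = 0 -> (forall i, (i < k)%N -> \val (t i) < \val (t i.+1)) ->
  chi2_le (distribution (signal_law W f) (grid_increments t k))
    (distribution (signal_law W (fun=> 0)) (grid_increments t k))
    (expR (\int[mu]_(x in `[0, 1]) (f x ^+ 2))).
Proof.
move=> mf f2_int t0 t_lt.
have f_int := integrable_of_sqr mf f2_int.
have int0 : mu.-integrable `[0, 1] (EFin \o (fun=> 0 : R)).
  exact: integrable0.
pose a j := primitive f (t j.+1) - primitive f (t j).
pose D j := \val (t j.+1) - \val (t j).
pose c i := if i is j.+1 then expR (a j ^+ 2 / D j) else 1.
apply: (@chi2_le_eq _ _ _ (product_law (increment_law f t) k.+1)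
  (product_law (increment_law (fun=> 0) t) k.+1)).
- by move=> A mA; exact/esym/(increments_law f_int t0 t_lt).
- by move=> A mA; exact/esym/(increments_law int0 t0 t_lt).
apply: (@chi2_le_mono _ _ _ _ _ (\prod_(i < k.+1) c i)).
  pose En x := \int[mu]_(y in `[0, x]) (f y ^+ 2).
  rewrite big_ord_recl mul1r /= -expR_sum ler_expR.
  apply: (@le_trans _ _ (\sum_(i < k) (En (\val (t i.+1)) - En (\val (t i))))).
    apply: ler_sum => i _.
    have /andP[ti0 _] := val_time_itv (t i).
    have /andP[_ ti1] := val_time_itv (t i.+1).
    by apply: sqr_increment_le => //; exact: (t_lt _ (ltn_ord i)).
  rewrite -(big_mkord xpredT (fun i => En (\val (t i.+1)) - En (\val (t i)))).
  rewrite (telescope_sumr (fun i => En (\val (t i))))//.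
  have /andP[tk0 tk1] := val_time_itv (t k).
  have : 0 <= En 1 - En (\val (t k)).
    rewrite /En Rintegral_itvB ?bnd_simp//.
    by apply: Rintegral_ge0 => x _; exact: sqr_ge0.
  have : 0 <= En (\val (t 0%N)) by apply: Rintegral_ge0 => x _; exact: sqr_ge0.
  by rewrite -/(En 1); lra.
apply: chi2_le_product_law => -[|i] //=.
  by move=> _; apply: chi2_le_dirac.
rewrite ltnS => ik.
have -> : primitive (fun=> 0) (t i.+1) - primitive (fun=> 0) (t i) = 0 :> R.
  by rewrite /primitive !Rintegral_cst// !mul0r subrr.
have Di : 0 < D i by rewrite subr_gt0 t_lt.
have s0 : Num.sqrt (D i) != 0 by rewrite sqrtr_eq0 -ltNge.
have := @chi2_le_normal _ (a i) _ s0.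
by rewrite sqr_sqrtr// ltW.
Qed.
(** The cylinder events form an algebra because any finite set of times is
    contained in a grid; the bound on grids is uniform, so it extends. *)
Lemma chi2_le_signal_law (f : R -> R) :
  measurable_fun (`[0, 1]%classic : set R) f ->
  mu.-integrable `[0, 1] (fun x => (f x ^+ 2)%:E) ->
  chi2_le (signal_law W f) (signal_law W (fun=> 0))
    (expR (\int[mu]_(x in `[0, 1]) (f x ^+ 2))).
Proof.
move=> mf f2_int.
pose G := [set A | exists s, @cylinders R s A].
apply: (@chi2_le_algebra _ _ _ _ _ _ G).
- exact: expR_gt0.
- by exists [::]; exact: sigma_algebra0.
- by move=> A [s sA]; exists s; rewrite -setTD; exact: sigma_algebraCD.
- move=> A B [s sA] [s' sB]; exists (s ++ s').
  rewrite -bigcup2E; apply: sigma_algebra_bigcup => -[|[|i]] /=.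
  + by apply: sub_cylinders sA => u us; rewrite mem_cat us.
  + by apply: sub_cylinders sB => u us; rewrite mem_cat us orbT.
  + exact: sigma_algebra0.
- apply/seteqP; split.
    apply: smallest_sub; first exact: smallest_sigma_algebra.
    move=> A [u _ uA]; apply: sub_sigma_algebra; exists [:: u].
    by apply: sub_sigma_algebra; exists u => //=; rewrite mem_head.
  apply: smallest_sub; first exact: sigma_algebra_measurable.
  move=> A [s]; apply: smallest_sub; first exact: sigma_algebra_measurable.
  by move=> B [u _ uB]; apply: sub_sigma_algebra; exists u.
move=> m a A a0 GA.
have [s sA] : exists s, forall i, @cylinders R s (A i).
  have [s_ sA] := choice GA; exists (flatten [seq s_ i | i <- enum 'I_m]) => i.
  apply: sub_cylinders (sA i) => u ui; apply/flattenP; exists (s_ i) => //.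
  by apply: map_f; rewrite mem_enum.
have [k [t [t0 t_lt st]]] := exists_grid s.
have [B mB AE] : exists2 B : 'I_m -> set (k.+1.-tuple R'),
    forall i, measurable (B i) & forall i, A i = grid_increments t k @^-1` B i.
  have [i|B HB] := @choice _ _
      (fun i B => measurable B /\ A i = grid_increments t k @^-1` B).
    have [B mB AE] := cylinders_grid st (sA i).
    by exists B.
  by exists B => i; case: (HB i).
have stepE w : step_fun a A w = step_fun a B (grid_increments t k w).
  by apply: eq_bigr => i _; rewrite AE !indicE.
have mstep : measurable_fun setT (fun y => (step_fun a B y)%:E).
  apply/measurable_EFinP; apply: measurable_sum => i.
  by apply: measurable_funM => //; exact: measurable_indic.
have step0 y : (0 <= (step_fun a B y)%:E)%E by rewrite lee_fin step_fun_ge0.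
have intE (P : probability (cpath R) R) (h : \bar R -> \bar R) :
    measurable_fun setT (fun y => h (step_fun a B y)%:E) ->
    (forall y, 0 <= h (step_fun a B y)%:E)%E ->
    (\int[P]_w h (step_fun a A w)%:E =
     \int[distribution P (grid_increments t k)]_y h (step_fun a B y)%:E)%E.
  move=> mh h0; rewrite ge0_integral_distribution//.
  by apply: eq_integral => w _; rewrite stepE.
rewrite (intE _ id)// (intE _ (fun z => z ^+ 2)%E).
- exact: (chi2_le_cylinder mf f2_int t0 t_lt mstep step0).
- exact: (measurable_fun_expe2 mstep).
- by move=> y; exact: expe2_ge0.
Qed.

End cameron_martin.

(** * Contaminations that hide a small change of law *)

Section coupling.
Context (R : realType) d (T : measurableType d).

(** Test [chi2_le] on [1 + dl * 1_A]: the first-order terms in [dl] compare [P A]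
    with [Q A]. *)
Lemma chi2_le_total_variation (P Q : probability T R) (dl : R) :
  0 < dl -> dl <= 1 -> chi2_le P Q (1 + dl ^+ 2) ->
  forall A, measurable A -> fine (P A) - fine (Q A) <= 3 * dl.
Proof.
move=> dl0 dl1 PQ A mA.
pose a (i : 'I_2) := if i == ord0 then 1 else dl.
pose S (i : 'I_2) := if i == ord0 then [set: T] else A.
have a0 i : 0 <= a i by rewrite /a; case: ifP => _; rewrite ?ltW.
have mS i : measurable (S i) by rewrite /S; case: ifP.
have mstep : measurable_fun setT (fun y => (step_fun a S y)%:E).
  apply/measurable_EFinP; apply: measurable_sum => i.
  by apply: measurable_funM => //; exact: measurable_indic.
have step0 y : (0 <= (step_fun a S y)%:E)%E by rewrite lee_fin step_fun_ge0.
have := PQ _ mstep step0.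
rewrite integral_step_fun// integral_sqr_step_fun//.
rewrite -EFin_expe -EFinM lee_fin !big_ord_recl !big_ord0 /a /S /= !addr0.
rewrite !setTI !setIT !setIid !probability_setT/= !mul1r !mulr1.
set p := fine (P A); set q := fine (Q A).
have q1 : q <= 1 by rewrite -lee_fin fineK ?fin_num_measure// probability_le1.
have q0 : 0 <= q by exact: fine_ge0.
have p0 : 0 <= p by exact: fine_ge0.
rewrite !expr2 => le; rewrite -(ler_pM2l dl0).
have e0 : 0 <= dl * dl by rewrite mulr_ge0 ?ltW.
have dq : dl * q <= 1 by nra.
have eq1 : dl * dl * q <= 1 by nra.
have h1 : dl * dl * q <= dl * dl by nra.
have h2 : dl * dl * (dl * q) <= dl * dl by nra.
have h3 : dl * dl * (dl * dl * q) <= dl * dl by nra.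
have h4 : 0 <= (dl * p) * (dl * p) by have := mulr_ge0 (ltW dl0) p0; nra.
nra.
Qed.

(** One needs [(1 - eps) * (P1 - P0) = eps * (Q0 - Q1)].  So [Q0] and [Q1] are
    rescaled positive and negative parts of the charge [P1 - P0]; these have the
    same mass [tau], the total variation distance, and as [tau <= eps] what is
    missing to mass 1 can be filled with the same law [P0] on both sides. *)
Lemma hidden_change (P0 P1 : probability T R) (eps : {i01 R}) :
  0 < eps%:num ->
  (forall A, measurable A -> fine (P1 A) - fine (P0 A) <= eps%:num) ->
  exists Q0 Q1 : probability T R, forall A, measurable A ->
    contaminate eps P0 Q0 A = contaminate eps P1 Q1 A.
Proof.
move=> eps0 tv.
pose nu := cadd (charge_of_finite_measure P1)
  (cscale (-1) (charge_of_finite_measure P0)).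
have [H [N HN]] := Hahn_decomposition nu.
pose jp : {finite_measure set T -> \bar R} := jordan_pos HN.
pose jn : {finite_measure set T -> \bar R} := jordan_neg HN.
have jfin (j : {finite_measure set T -> \bar R}) A :
  measurable A -> j A \is a fin_num by exact: fin_num_measure.
have decomp A : measurable A ->
    fine (P1 A) - fine (P0 A) = fine (jp A) - fine (jn A).
  move=> mA; have eqA : (P1 A + (-1)%:E * P0 A = jp A + (-1)%:E * jn A)%E.
    exact: (jordan_decomp HN mA).
  rewrite !EFinN !mulN1e in eqA.
  by rewrite -!fineB ?fin_num_measure// eqA.
pose tau := fine (jp setT).
have tau0 : 0 <= tau by exact: fine_ge0.
have tauE : fine (jn setT) = tau.
  have := decomp setT measurableT; rewrite !probability_setT subrr => /eqP.
  by rewrite eq_sym subr_eq0 => /eqP.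
have [PH _ _ _] := HN.
have tau_le : tau <= eps%:num.
  have mH : measurable H by case: PH.
  have jpT : jp setT = (P1 H + (-1)%:E * P0 H)%E.
    rewrite /jp/= jordan_posE cjordan_posE /crestr0 mem_set// /crestr setTI.
    by [].
  apply: le_trans (tv H mH); rewrite /tau jpT EFinN mulN1e.
  by rewrite fineB ?fin_num_measure.
pose rho := 1 - eps%:num.
have rho0 : 0 <= rho by rewrite subr_ge0.
have eta01 : 0 <= rho * tau / eps%:num <= 1.
  rewrite divr_ge0 ?mulr_ge0//= ler_pdivrMr// mul1r.
  apply: le_trans tau_le; rewrite ler_piMl// /rho lerBlDr lerDl//.
pose eta : {i01 R} := Itv01 (proj1 (andP eta01)) (proj2 (andP eta01)).
(* If [tau = 0] the normalised measure is replaced by [P0], with weight 0. *)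
have half (j : {measure set T -> \bar R}) A :
    (forall B, measurable B -> j B \is a fin_num) ->
    fine (j setT) = tau -> measurable A ->
    contaminate eta P0 (mnormalize j P0) A =
    ((1 - eta%:num) * fine (P0 A) + rho / eps%:num * fine (j A))%:E.
  move=> {}jfin jT mA.
  have jTE : j setT = tau%:E by rewrite -jT fineK// jfin.
  have nE : mnormalize j P0 A =
      if tau == 0 then P0 A else (j A * (tau^-1)%:E)%E.
    by rewrite /mnormalize jTE eqe orbF; case: ifP.
  transitivity ((1 - eta%:num)%:E * P0 A + eta%:num%:E * mnormalize j P0 A)%E
    => //.
  rewrite nE -[P0 A]fineK ?fin_num_measure//= /rho.
  have [tau_eq0|tau_neq0] := eqVneq tau 0.
    have jA0 : fine (j A) = 0.
      apply/eqP; rewrite eq_le fine_ge0 ?andbT//.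
      rewrite -tau_eq0 -jT fine_le ?jfin//.
      by apply: le_measure; rewrite ?inE.
    by rewrite tau_eq0 jA0 !mulr0 mul0r mul0e adde0 addr0.
  rewrite -[j A]fineK ?jfin// -!EFinM -EFinD; congr EFin.
  by field; rewrite gt_eqF.
exists (contaminate eta P0 (mnormalize jp P0)),
       (contaminate eta P0 (mnormalize jn P0)) => A mA.
transitivity (rho%:E * P0 A + eps%:num%:E *
  contaminate eta P0 (mnormalize jp P0) A)%E => //.
transitivity (rho%:E * P1 A + eps%:num%:E *
  contaminate eta P0 (mnormalize jn P0) A)%E => //.
rewrite (half jp)//; last exact: jfin.
rewrite (half jn)//; last exact: jfin.
rewrite -[P0 A]fineK ?fin_num_measure// -[P1 A]fineK ?fin_num_measure//.
rewrite -!EFinM -!EFinD; congr EFin.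
have jj := decomp A mA; have e_neq0 := lt0r_neq0 eps0.
rewrite -/rho.
have -> : fine (jp A) = fine (jn A) + (fine (P1 A) - fine (P0 A)).
  by rewrite jj addrC subrK.
by field.
Qed.

Lemma contaminate_self (eps : {i01 R}) (P : probability T R) A :
  measurable A -> contaminate eps P P A = P A.
Proof.
move=> mA; transitivity ((1 - eps%:num)%:E * P A + eps%:num%:E * P A)%E => //.
rewrite -[P A]fineK ?fin_num_measure// -!EFinM -EFinD; congr EFin; ring.
Qed.

Lemma eq_iid (P P' : probability T R) n :
  (forall A, measurable A -> P A = P' A) ->
  forall A, measurable A -> iid P n A = iid P' n A.
Proof.
move=> PP'; apply: eq_measure_box => B mB.
by rewrite !iidE !product_law_box//; apply: eq_bigr => i _; exact: PP'.
Qed.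

End coupling.

(** * Well separated wavelets of one level *)

Section wavelets.
Context (R : realType).
Notation mu := (@lebesgue_measure R).

(** The refinement equation turns the support of [phi] into one for [psi]. *)
Lemma daubechies_support (N : nat) (phi psi : R -> R) x :
  daubechies N phi psi -> psi x != 0 -> 1 - N%:R <= x <= N%:R.
Proof.
move=> [[N0 _ phi0 _ _] [[h phih] _]]; apply: contraR => xN.
have [_ ->] := phih x; rewrite big1 ?mulr0// => i _.
rewrite [phi _]phi0 ?mulr0//; rewrite in_itv/=.
have i2N : (i%:R : R) <= 2 * N%:R - 1.
  rewrite lerBrDr -[1]/(1%:R) -natrD -natrM ler_nat addn1 mul2n.
  exact: ltn_ord.
have i0 : 0 <= (i%:R : R) by exact: ler0n.
apply: contra xN => /andP[H1 H2]; apply/andP; split; lra.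
Qed.

(** Interior wavelets of one level are translates of [psi], which vanishes outside
    an interval of length [2 * N - 1]; translations by multiples of [2 * N] thus
    have disjoint supports.  [psi] does not vanish identically because the
    wavelets are normalised, so each translate attains a fixed multiple of
    [2 ^ (j / 2)] at a point where the others vanish.  The relabelling of the
    family moves the level by at most [D]. *)
Lemma separated_wavelets (Psi : nat -> nat -> R -> R) :
  orthonormal_basis01 Psi -> cdv_wavelets Psi ->
  exists (J D : nat) (kappa : R), 0 < kappa /\
  forall j, (J <= j)%N -> exists (l k : nat -> nat) (x : nat -> R),
    forall i, (i < 2 ^ (j - J))%N ->
    [/\ (k i < 2 ^ l i)%N, (l i <= j + D)%N, 0 <= x i <= 1 &
        `|Psi (l i) (k i) (x i)| = kappa * Num.sqrt (2 ^+ j)] /\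
    forall i', (i' < 2 ^ (j - J))%N -> i' != i -> Psi (l i') (k i') (x i) = 0.
Proof.
move=> [_ Psi_orth _] [N [J [phi [psi [sl [wl [sr [wr [sigma [D]]]]]]]]]].
move=> [[daub NJ _ _] [[sigma_fun sigma_inj sigma_surj] sigmaD PsiE]].
have N0 : (0 < N)%N by case: daub => -[].
have level j k : (J <= j)%N -> (N <= k)%N -> (k < 2 ^ j - N)%N ->
    exists l k' : nat, [/\ (k' < 2 ^ l)%N, (l <= j + D)%N &
      forall x, 0 <= x <= 1 -> Psi l k' x = Num.sqrt (2 ^+ j) * psi (2 ^+ j * x
        - k%:R)].
  move=> Jj Nk kj.
  have k2j : (k < 2 ^ j)%N by apply: leq_trans kj _; exact: leq_subr.
  have [[l k'] /= k'l sE] := sigma_surj (2 ^ j + k)%N I.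
  have logE : trunc_log 2 (2 ^ j + k) = j.
    by apply: trunc_log_eq => //; rewrite leq_addr expnS mul2n -addnn ltn_add2l.
  exists l, k'; have [] := sigmaD l k' k'l; rewrite sE logE => lj _.
  split=> // x x01; rewrite PsiE// sE /cdv_seq logE.
  rewrite ifF; last by apply/negbTE; rewrite -leqNgt (leq_trans _ (leq_addr _
    _))// leq_exp2l.
  by rewrite addKn /cdv_level ifF ?kj//; apply/negbTE; rewrite -leqNgt.
have psi_neq0 : exists x0, psi x0 != 0.
  apply: contrapT => /forallNP psi0.
  have NJ1 : (N < 2 ^ J.+1 - N)%N.
    by rewrite ltn_subRL addnn (leq_ltn_trans NJ)// ltn_exp2l.
  have [l [k' [k'l _ PsilE]]] := level J.+1 N (leqnSn _) (leqnn _) NJ1.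
  have := Psi_orth l k' l k' k'l k'l; rewrite eqxx/= /dotL2.
  rewrite (_ : \int[mu]_(x in _) _ = \int[mu]_(x in `[0, 1]) (0 : R)).
    by rewrite Rintegral_cst// mul0r => /eqP; rewrite eq_sym oner_eq0.
  apply: eq_Rintegral => x; rewrite inE/= in_itv/= => x01.
  rewrite PsilE//; have := psi0 (2 ^+ J.+1 * x - N%:R).
  by move=> /negP; rewrite negbK => /eqP ->; rewrite !mulr0.
have [x0 psix0] := psi_neq0.
have /andP[x0N x0N'] := daubechies_support daub psix0.
exists J.+1, D, `|psi x0|; split; first by rewrite normr_gt0.
move=> j J1j; have Jj := ltnW J1j.
pose K i := (N + i * N.*2)%N.
have KP i : (i < 2 ^ (j - J.+1))%N -> (K i < 2 ^ j - N)%N.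
  move=> ilt; rewrite ltn_subRL addnA addnn -mulSn.
  apply: (@leq_ltn_trans (2 ^ (j - J.+1) * 2 ^ J)%N); first exact: leq_mul.
  by rewrite -expnD ltn_exp2l//; move: J1j; lia.
have [i|lk lkE] := @choice nat (nat * nat) (fun i lk => (K i < 2 ^ j - N)%N ->
    [/\ (lk.2 < 2 ^ lk.1)%N, (lk.1 <= j + D)%N &
      forall x, 0 <= x <= 1 -> Psi lk.1 lk.2 x =
        Num.sqrt (2 ^+ j) * psi (2 ^+ j * x - (K i)%:R)]).
  have [Ki|Ki] := ltnP (K i) (2 ^ j - N)%N; last by exists (0, 0)%N.
  have [l [k' H]] := level j (K i) Jj (leq_addr _ _) Ki.
  by exists (l, k').
exists (fst \o lk), (snd \o lk), (fun i => ((K i)%:R + x0) / 2 ^+ j) => i /KP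
  Ki.
have [k'l lj PsiK] := lkE i Ki.
have p0 : 0 < 2 ^+ j :> R by rewrite exprn_gt0.
have x01 : 0 <= ((K i)%:R + x0) / 2 ^+ j <= 1.
  rewrite divr_ge0 ?(ltW p0)//=; last first.
    have : (N%:R : R) <= (K i)%:R by rewrite ler_nat leq_addr.
    by lra.
  rewrite ler_pdivrMr// mul1r.
  have : ((K i + N.+1)%:R : R) <= (2 ^ j)%:R.
    by rewrite ler_nat addnS; move: Ki; rewrite ltn_subRL addnC.
  by rewrite natrD natrX -natr1; lra.
have xE : 2 ^+ j * (((K i)%:R + x0) / 2 ^+ j) = (K i)%:R + x0.
  by rewrite mulrC divfK// gt_eqF.
split=> [|i' /KP Ki' ii'].
  split=> //=; rewrite PsiK// xE [_ + x0]addrC addrK normrM mulrC.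
  by rewrite [`|Num.sqrt _|]ger0_norm// sqrtr_ge0.
have [_ _ PsiK'] := lkE i' Ki'; rewrite /= PsiK'// xE.
have [->|/(daubechies_support daub)] := eqVneq (psi ((K i)%:R + x0 - (K
  i')%:R)) 0.
  by rewrite mulr0.
have N1 : (1 : R) <= N%:R by rewrite ler1n.
move=> /andP[]; rewrite /K !natrD !natrM -muln2 !natrM.
case: (ltngtP i' i) => [lt|lt|ii]; last by rewrite ii eqxx in ii'.
  have : (i'.+1%:R : R) <= i%:R by rewrite ler_nat.
  by rewrite -natr1; nra.
have : (i.+1%:R : R) <= i'%:R by rewrite ler_nat.
by rewrite -natr1; nra.
Qed.

End wavelets.

(** * Multiples of one wavelet *)

Section one_wavelet.
Context (R : realType).
Notation mu := (@lebesgue_measure R).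
Variables (Psi : nat -> nat -> R -> R) (beta M : R).

Lemma wavelet_in_holder_ball (l k : nat) (g : R) : 0 <= M -> (k < 2 ^ l)%N ->
  2 `^ (l%:R * (2^-1 + beta)) * `|g| <= M ->
  holder_ball Psi beta M (fun x => g * Psi l k x).
Proof.
move=> M0 kl gM.
exists (fun l' k' => if (l', k') == (l, k) then g else 0); split.
  by move=> l' k' _; case: eqP => [[-> _]//|_]; rewrite normr0 mulr0.
move=> x _; apply: cvg_near_cst; near=> L.
have lL : (l < L)%N by near: L; exact: nbhs_infty_gt.
rewrite (bigD1 (Ordinal lL))//= (bigD1 (Ordinal kl))//= eqxx.
rewrite big1 => [|i ik]; last first.
  rewrite ifF ?mul0r//; apply/negbTE; apply: contra ik => /eqP[ik].
  exact/eqP/val_inj.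
rewrite big1 ?addr0// => i il; rewrite big1// => i' _.
rewrite ifF ?mul0r//; apply/negbTE; apply: contra il => /eqP[il _].
exact/eqP/val_inj.
Unshelve. all: by end_near. Qed.

Lemma zero_in_holder_ball : 0 <= M -> holder_ball Psi beta M (fun=> 0).
Proof.
move=> M0; rewrite (_ : (fun=> 0) = fun x => 0 * Psi 0 0 x); last first.
  by apply/funext => x; rewrite mul0r.
by apply: wavelet_in_holder_ball => //; rewrite normr0 mulr0.
Qed.

Hypothesis PsiB : orthonormal_basis01 Psi.

(** The energy of [g * Psi l k] is [g ^+ 2] by orthonormality. *)
Lemma chi2_le_wavelet d (Omega : measurableType d) (Pr : probability Omega R)
    (W : {RV Pr >-> cpath R}) (l k : nat) (g : R) :
  standard_wiener W -> (k < 2 ^ l)%N ->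
  chi2_le (signal_law W (fun x => g * Psi l k x)) (signal_law W (fun=> 0))
    (expR (g ^+ 2)).
Proof.
move=> WW kl; have [mPsi Psi_orth _] := PsiB.
have mI := mPsi l k kl.
have := Psi_orth l k l k kl kl; rewrite eqxx /dotL2/= => norm1.
have int : mu.-integrable `[0, 1] (fun x => (Psi l k x ^+ 2)%:E).
  apply/integrableP; split.
    by apply/measurable_EFinP; exact: measurable_funX.
  under eq_integral do rewrite gee0_abs ?lee_fin ?sqr_ge0//.
  rewrite ltey; apply/eqP => oo; move: norm1; rewrite /Rintegral.
  under eq_integral do rewrite -expr2.
  by rewrite oo/= => /eqP; rewrite eq_sym oner_eq0.
have -> : g ^+ 2 = \int[mu]_(x in `[0, 1]) ((g * Psi l k x) ^+ 2).
  under eq_Rintegral do rewrite exprMn.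
  by rewrite RintegralZl// [X in _ * X](norm1 : _ = 1) mulr1.
apply: chi2_le_signal_law => //.
  by apply: measurable_funM => //; exact: measurable_cst.
rewrite [X in integrable _ _ X](_ : _ =
    (fun x => (g ^+ 2)%:E * (Psi l k x ^+ 2)%:E)%E).
  exact: integrableZl.
by apply/funext => x; rewrite exprMn EFinM.
Qed.

End one_wavelet.

(** * From indistinguishable hypotheses to the minimax risk *)

Section testing.
Context (R : realType).

Lemma chi2_le_set d (T : measurableType d) (P Q : probability T R) (c : R) A :
  measurable A -> chi2_le P Q c -> fine (P A) ^+ 2 <= c * fine (Q A).
Proof.
move=> mA PQ.
have mI : measurable_fun setT (fun x : T => (\1_A x : R)%:E).
  exact/measurable_EFinP/measurable_indic.
have I0 (x : T) : (0 <= (\1_A x : R)%:E)%E by rewrite lee_fin.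
have := PQ _ mI I0.
have -> : (\int[Q]_x ((\1_A x : R)%:E ^+ 2) = \int[Q]_x (\1_A x : R)%:E)%E.
  apply: eq_integral => x _; rewrite expe2 -EFinM indicE; congr EFin.
  by case: (x \in A); rewrite ?mulr1 ?mulr0.
by rewrite !integral_indic// !setIT -lee_fin EFin_expe EFinM !fineK
  ?fin_num_measure.
Qed.

(** Disjoint events cannot all be likely under laws that are close to a common
    one, for one of them has probability at most [1 / K] under the latter. *)
Lemma unlikely_event d (T : measurableType d) (Q : probability T R)
    (P : nat -> probability T R) (A : nat -> set T) (c : R) (K : nat) :
  (0 < K)%N -> 4 * c <= K%:R ->
  (forall i, (i < K)%N -> chi2_le (P i) Q c) ->
  (forall i, (i < K)%N -> measurable (A i)) ->
  (forall i j, (i < K)%N -> (j < K)%N -> A i `&` A j !=set0 -> i = j) ->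
  exists2 i, (i < K)%N & fine (P i (A i)) <= 2^-1.
Proof.
move=> K0 cK PQ mA disj.
have KR : 0 < K%:R :> R by rewrite ltr0n.
have sumQ : \sum_(i < K) fine (Q (A i)) <= 1.
  rewrite -lee_fin -sumEFin.
  have -> : (\sum_(i < K) (fine (Q (A i)))%:E = \sum_(i < K) Q (A i))%E.
    by apply: eq_bigr => i _; rewrite fineK// fin_num_measure//; exact: mA.
  rewrite -(@measure_bigsetU_ord _ _ _ Q K xpredT (fun i => A i)).
  - by apply: probability_le1; apply: bigsetU_measurable => i _; exact: mA.
  - by move=> i; exact: mA.
  - by move=> i j _ _ ij; apply: val_inj; exact: disj (ltn_ord i) (ltn_ord j)
    ij.
have [i QA] : exists i : 'I_K, fine (Q (A i)) <= K%:R^-1.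
  apply: contrapT => /forallNP H.
  have : \sum_(i < K) K%:R^-1 < \sum_(i < K) fine (Q (A i)).
    apply: ltr_sum => [|i _].
      by apply/hasP; exists (Ordinal K0); rewrite ?mem_index_enum.
    by rewrite ltNge; apply/negP; exact: H.
  by rewrite sumr_const card_ord -(mulr_natr K%:R^-1) mulVf ?gt_eqF// ltNge
    sumQ.
exists i => //; have p0 : 0 <= fine (P i (A i)) by exact: fine_ge0.
have := chi2_le_set (mA i (ltn_ord i)) (PQ i (ltn_ord i)).
have [c0|c0] := leP 0 c; last first.
  have q0 : 0 <= fine (Q (A i)) by exact: fine_ge0.
  by nra.
have : c * fine (Q (A i)) <= c * K%:R^-1 by rewrite ler_wpM2l.
have : c * K%:R^-1 <= 4^-1 by rewrite ler_pdivrMr//; lra.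
by nra.
Qed.

Lemma sqr_supdist01_le (g f : R -> R) (r x : R) :
  (supdist01 g f ^+ 2 <= r%:E)%E -> 0 <= x <= 1 -> (g x - f x) ^+ 2 <= r.
Proof.
move=> le x01; rewrite -lee_fin; apply: le_trans le.
rewrite -real_normK ?num_real// EFin_expe; apply: lee_sqr;
  first by rewrite lee_fin.
by apply: ereal_sup_ubound; exists x => //=; rewrite in_itv.
Qed.

End testing.

Section minimax.
Context (R : realType) d (Omega : measurableType d) (Pr : probability Omega R).
Variables (W : {RV Pr >-> cpath R}) (H : set (R -> R)) (n : nat)
  (eps : {i01 R}) (r : R).

Let excess (fhat : n.-tuple (cpath R) -> R -> R) (f : R -> R) :
  set (n.-tuple (cpath R)) := [set y | (r%:E < supdist01 (fhat y) f ^+ 2)%E].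

Let law f := signal_law W f.

Let measurable_excess fhat f : @estimator R H n fhat -> H f ->
  measurable (excess fhat f).
Proof.
move=> est Hf; rewrite /excess -[X in measurable X]setTI.
apply: emeasurable_fun_o_infty => //.
exact: (measurable_fun_expe2 (est f Hf)).
Qed.

Let not_excess fhat f y x : ~ excess fhat f y -> 0 <= x <= 1 ->
  (fhat y x - f x) ^+ 2 <= r.
Proof.
by move=> /negP; rewrite -leNgt => le x01; exact: sqr_supdist01_le le x01.
Qed.

Let minimax_excess_ge (b : R) :
  (forall fhat, @estimator R H n fhat -> exists f Q, H f /\
     (b%:E <= iid (contaminate eps (law f) Q) n (excess fhat f))%E) ->
  (b%:E <= minimax_excess H W n eps r)%E.
Proof.
move=> bex; apply: le_ereal_inf_tmp => _ [fhat est <-].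
have [f [Q [Hf bQ]]] := bex fhat est; apply: le_trans bQ _.
by apply: ereal_sup_ubound; exists (f, Q).
Qed.

(** If the loss at [f i] and at [f j] were both small, the two functions would be
    closer than they are at their separating point; so the events of small loss
    are disjoint. *)
Lemma minimax_excess_many (f : nat -> R -> R) (c : R) (K : nat) :
  (0 < K)%N -> 0 <= c -> 4 * c ^+ n <= K%:R ->
  (forall i, (i < K)%N -> H (f i)) ->
  (forall i, (i < K)%N -> chi2_le (law (f i)) (law (fun=> 0)) c) ->
  (forall i j, (i < K)%N -> (j < K)%N -> i != j ->
     exists2 x, 0 <= x <= 1 & 4 * r < (f i x - f j x) ^+ 2) ->
  ((2^-1 : R)%:E <= minimax_excess H W n eps r)%E.
Proof.
move=> K0 c0 cK Hf chi sep; apply: minimax_excess_ge => fhat est.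
pose P i := iid (contaminate eps (law (f i)) (law (f i))) n.
have chiP i : (i < K)%N -> chi2_le (P i) (iid (law (fun=> 0)) n) (c ^+ n).
  move=> iK; apply: (@chi2_le_eq _ _ _ (iid (law (f i)) n) (iid (law (fun=> 0))
    n)).
  - by move=> A mA; apply: eq_iid mA => B mB; exact/esym/contaminate_self.
  - by [].
  - exact/chi2_le_iid/chi.
have mE i : (i < K)%N -> measurable (excess fhat (f i)).
  by move=> iK; apply: measurable_excess => //; exact: Hf.
have disj i j : (i < K)%N -> (j < K)%N ->
    ~` excess fhat (f i) `&` ~` excess fhat (f j) !=set0 -> i = j.
  move=> iK jK [y [Ei Ej]]; apply/eqP/negPn/negP => ij.
  have [x x01] := sep i j iK jK ij; rewrite ltNge => /negP; apply.
  have := not_excess Ei x01; have := not_excess Ej x01.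
  by have := sqr_ge0 ((fhat y x - f i x) + (fhat y x - f j x)); nra.
have [i iK Pi] := unlikely_event K0 cK chiP
  (fun i iK => measurableC (mE i iK)) disj.
exists (f i), (law (f i)); split; first exact: Hf.
move: Pi; rewrite probability_setC; last exact: mE.
rewrite -/(P i) -[P i _]fineK; last by rewrite fin_num_measure//; exact: mE.
by rewrite -EFinB/= lee_fin; lra.
Qed.

(** The sample has the same law under both hypotheses, and no estimator is close
    to both 0 and [f], so one of two events with union the whole space has
    probability at least one half. *)
Lemma minimax_excess_two (f : R -> R) (dl x : R) :
  H (fun=> 0) -> H f -> 0 < dl -> dl <= 1 -> 3 * dl <= eps%:num ->
  chi2_le (law f) (law (fun=> 0)) (1 + dl ^+ 2) ->
  0 <= x <= 1 -> 4 * r < f x ^+ 2 ->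
  ((2^-1 : R)%:E <= minimax_excess H W n eps r)%E.
Proof.
move=> H0 Hf dl0 dl1 dle chi x01 sep; apply: minimax_excess_ge => fhat est.
have eps0 : 0 < eps%:num by apply: lt_le_trans dle; rewrite mulr_gt0.
have [A mA|Q0 [Q1 QE]] := @hidden_change _ _ _ (law (fun=> 0)) (law f) eps eps0.
  exact: le_trans (chi2_le_total_variation dl0 dl1 chi mA) dle.
pose P0 := iid (contaminate eps (law (fun=> 0)) Q0) n.
pose P1 := iid (contaminate eps (law f) Q1) n.
have m0 := measurable_excess est H0; have m1 := measurable_excess est Hf.
have PE : P0 (excess fhat f) = P1 (excess fhat f) by exact: eq_iid.
have [le|lt] := leP (2^-1%:E) (P0 (excess fhat (fun=> 0))).
  by exists (fun=> 0), Q0.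
exists f, Q1; split => //; rewrite -/P1 -PE.
have : (1 <= P0 (excess fhat (fun=> 0%R)) + P0 (excess fhat f))%E.
  rewrite -(probability_setT P0); apply: le_trans (@measureU2 _ _ _ P0 _ _ m0
    m1).
  apply: le_measure; rewrite ?inE//; first exact: measurableU.
  move=> y _; apply: contrapT => /not_orP[n0 n1].
  have := not_excess n0 x01; have := not_excess n1 x01.
  by move: sep; have := sqr_ge0 (2 * fhat y x - f x); nra.
move: lt; rewrite -[P0 _]fineK ?fin_num_measure// -[P0 (excess _ f)]fineK
  ?fin_num_measure//.
by rewrite lte_fin -EFinD !lee_fin; lra.
Qed.

End minimax.

(** * Calibration of the resolution level *)

Section calibration.
Context (R : realType).
Implicit Types (u v x q : R).

Let two_neq0 : (2 : R) != 0. Proof. by rewrite pnatr_eq0. Qed.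

Lemma powR2D u v : 2 `^ (u + v) = 2 `^ u * 2 `^ v :> R.
Proof. by rewrite powRD// two_neq0 implybT. Qed.

Lemma powR2_gt0 u : 0 < 2 `^ u :> R.
Proof. by rewrite powR_gt0. Qed.

Lemma ler_powR2 u v : u <= v -> 2 `^ u <= 2 `^ v :> R.
Proof. by move=> uv; apply: ler_powR => //; rewrite ler1n. Qed.

(** Take the first level [j >= j0] with [x <= 2 ^ (j * q)]: either it is [j0], or
    the bound fails one level below, so that [2 ^ (j * q)] exceeds [x] at most by
    the factor [2 ^ q]. *)
Lemma level_selection q (j0 : nat) x : 1 <= q -> 1 <= x ->
  exists j, [/\ (j0 <= j)%N, x <= 2 `^ (j%:R * q) &
    2 `^ (j%:R * q) <= 2 `^ (j0.+1%:R * q) * x].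
Proof.
move=> q1 x1; have q0 : 0 <= q by lra.
have x0 : 0 <= x by lra.
have ex : exists j, (j0 <= j)%N && (x <= 2 `^ (j%:R * q)).
  exists (maxn j0 (Num.bound x)); rewrite leq_maxl/=.
  set j := maxn _ _; apply: (@le_trans _ _ j%:R).
    apply: ltW; apply: (lt_le_trans (archi_boundP x0)).
    by rewrite ler_nat leq_maxr.
  apply: (@le_trans _ _ (2 ^+ j)).
    by rewrite -natrX ler_nat ltnW// ltn_expl.
  by rewrite -powR_mulrn// ler_powR2// ler_peMr.
case: (ex_minnP ex) => j /andP[j0j xj] jmin; exists j; split => //.
move: j0j; rewrite leq_eqVlt => /orP[/eqP <-|j0j].
  apply: (@le_trans _ _ (2 `^ (j0.+1%:R * q))).
    by rewrite ler_powR2// ler_wpM2r// ler_nat.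
  by rewrite ler_peMr// ltW// powR2_gt0.
case: j xj jmin j0j => [//|j] xj jmin j0j.
have lt_x : 2 `^ (j%:R * q) < x.
  rewrite ltNge; apply/negP => xj1; have := jmin j.
  by rewrite xj1 andbT ltnn => /(_ j0j).
have -> : j.+1%:R * q = q + j%:R * q by rewrite -natr1; ring.
rewrite powR2D.
apply: ler_pM; [exact: powR_ge0|exact: powR_ge0| |exact: ltW].
by apply: ler_powR2; rewrite ler_peMl// ler1n.
Qed.

(** With [s = 2 * beta / q], this turns the bound on the selected level [v] into
    the lower bound for the squared amplitude [2 ^ (- v * 2 * beta)]. *)
Lemma powR2_level q s u v x : 0 <= s -> 0 < x ->
  2 `^ (v * q) <= 2 `^ (u * q) * x ->
  2 `^ (- (u * (q * s))) * x `^ (- s) <= 2 `^ (- (v * (q * s))).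
Proof.
move=> s0 x0 vu; have Ax0 : 0 < 2 `^ (u * q) * x by rewrite mulr_gt0 ?powR2_gt0.
rewrite !powRN -invfM lef_pV2 ?posrE ?mulr_gt0 ?powR_gt0//.
rewrite !mulrA (powRrM 2 (v * q)) (powRrM 2 (u * q)) -powRM ?powR_ge0 ?(ltW
  x0)//.
by apply: (ge0_ler_powR s0); rewrite ?nnegrE ?powR_ge0 ?(ltW Ax0).
Qed.

Lemma ln_lt_nat (n : nat) : (2 <= n)%N -> ln (n%:R : R) < n%:R.
Proof.
move=> n2; have n0 : 0 < n%:R :> R by rewrite ltr0n ltnW.
have := @le_ln1Dx R (n%:R - 1).
have -> : 1 + (n%:R - 1) = n%:R :> R by ring.
by move=> H; apply: le_lt_trans (H _) _; lra.
Qed.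

Lemma ln_nat_gt0 (n : nat) : (2 <= n)%N -> 0 < ln (n%:R : R).
Proof. by move=> n2; rewrite ln_gt0// ltr1n. Qed.

(** From [ln n = 2 * ln (sqrt n) <= 2 * sqrt n].  It serves to see that the number
    of wavelets at the chosen level is at least a power of [n]. *)
Lemma nat_le_sqr_ratio (n : nat) : (2 <= n)%N ->
  (n%:R : R) <= (2 * (n%:R / ln n%:R)) ^+ 2.
Proof.
move=> n2; have n0 : 0 < n%:R :> R by rewrite ltr0n ltnW.
have ln0 := ln_nat_gt0 n2.
pose s := Num.sqrt (n%:R : R); have s0 : 0 < s by rewrite sqrtr_gt0.
have s2 : s ^+ 2 = n%:R by rewrite sqr_sqrtr// ltW.
have lns : ln (n%:R : R) <= 2 * s.
  rewrite -s2 lnXn// mulr2n -mulr2n -[X in X <= _]mulr_natl ler_pM2l//.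
  have := @le_ln1Dx R (s - 1); have -> : 1 + (s - 1) = s by ring.
  by move=> H; apply: le_trans (H _) _; lra.
have ratio0 : 0 <= 2 * (n%:R / ln n%:R) :> R.
  by rewrite mulr_ge0// divr_ge0 ?(ltW n0) ?(ltW ln0).
rewrite -[leLHS]s2 ler_sqr ?nnegrE ?(ltW s0)// mulrA ler_pdivlMr//.
apply: (@le_trans _ _ (s * (2 * s))); first by rewrite ler_pM2l.
by rewrite -s2 expr2; lra.
Qed.

End calibration.

Section spikes.
Context (R : realType).
Variables (Psi : nat -> nat -> R -> R) (beta M : R).
Hypotheses (PsiB : orthonormal_basis01 Psi) (PsiW : cdv_wavelets Psi)
  (beta_gt0 : 0 < beta) (M_gt0 : 0 < M).
Let q : R := 2 * beta + 1.
(* Small enough both for [4 * (2 * x) ^ (2 * alpha)] to be below the number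
   [2 ^ (j - J)] of wavelets, and for [2 * alpha * eps ^ 2 <= (eps / 3) ^ 2]. *)
Let alpha : R := (18 * q)^-1.

(** The level [j] is chosen with [2 ^ (j * q)] of order [x].  A wavelet of nominal
    level [j] may have label [l] up to [j + D], so the coefficient is scaled for
    level [j + D], which keeps all the spikes in the ball with a common [g]. *)
Lemma spikes_at_scale : exists2 C : R, 0 < C & forall x : R, 1 <= x ->
  exists (K : nat) (l k : nat -> nat) (g : R) (t : nat -> R),
  [/\ (0 < K)%N, 4 * (2 * x) `^ (2 * alpha) <= K%:R, g ^+ 2 <= alpha / x &
  forall i, (i < K)%N ->
  [/\ (k i < 2 ^ l i)%N, holder_ball Psi beta M (fun y => g * Psi (l i) (k i)
    y),
      0 <= t i <= 1,
      4 * (C * x `^ (- (2 * beta / q))) < (g * Psi (l i) (k i) (t i)) ^+ 2 &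
      forall i', (i' < K)%N -> i' != i -> Psi (l i') (k i') (t i) = 0]].
Proof.
have q1 : 1 < q by rewrite /q ltrDr mulr_gt0.
have q0 : 0 < q by lra.
have alpha0 : 0 < alpha by rewrite invr_gt0 mulr_gt0.
have [J [D [kap [kap0 sep]]]] := separated_wavelets PsiB PsiW.
(* the margin 8 absorbs the constant factors in the count of wavelets *)
have [j0 j0E] : exists j0, j0 = (J.*2 + 8)%N by exists (J.*2 + 8)%N.
(* the first bound keeps the spikes in the ball, the second bounds their energy *)
pose dl := Num.min M (Num.sqrt alpha).
have dl0 : 0 < dl by rewrite lt_min M_gt0 sqrtr_gt0.
have dlM : dl <= M by rewrite ge_min lexx.
have dl2 : dl ^+ 2 <= alpha.
  rewrite -[leRHS]sqr_sqrtr ?(ltW alpha0)// ler_sqr ?nnegrE ?(ltW dl0)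
    ?sqrtr_ge0//.
  by rewrite ge_min lexx orbT.
pose C1 := dl ^+ 2 * kap ^+ 2 * 2 `^ (- (D%:R * q)) * 2 `^ (- (j0.+1%:R * (2 *
  beta))).
have C10 : 0 < C1 by rewrite !mulr_gt0 ?exprn_gt0 ?powR2_gt0.
exists (C1 / 8); first by rewrite divr_gt0.
move=> x x1; have x0 : 0 < x by lra.
have [j [j0j xj jx]] := level_selection j0 (ltW q1) x1.
have Jj : (J <= j)%N by move: j0j; rewrite j0E; lia.
have [l [k [t sepj]]] := sep j Jj.
pose g := dl * 2 `^ (- ((j + D)%:R * (2^-1 + beta))).
have g0 : 0 < g by rewrite mulr_gt0 ?powR2_gt0.
have g2 : g ^+ 2 = dl ^+ 2 * 2 `^ (- ((j + D)%:R * q)).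
  rewrite exprMn; congr (_ * _); rewrite expr2 -powR2D; congr (_ `^ _).
  by rewrite /q; field.
exists (2 ^ (j - J))%N, l, k, g, t; split.
- by rewrite expn_gt0.
- have x2 : 2 * x <= 2 `^ (1 + j%:R * q).
    by rewrite powR2D powRr1// ler_pM2l.
  have a2 : 0 <= 2 * alpha by rewrite mulr_ge0// ltW.
  apply: (@le_trans _ _ (2 `^ 2%:R * 2 `^ ((1 + j%:R * q) * (2 * alpha)))).
    rewrite powR_mulrn// (powRrM 2 _ (2 * alpha));
      have -> : (2 : R) ^+ 2 = 4 by ring.
    rewrite ler_pM2l//; apply: (ge0_ler_powR a2) => //;
      rewrite nnegrE ?powR_ge0//.
    by rewrite mulr_ge0// ltW.
  rewrite -powR2D natrX -(@powR_mulrn R 2 (j - J))//; apply: ler_powR2.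
  have -> : (1 + j%:R * q) * (2 * alpha) = 2 * alpha + j%:R / 9.
    by rewrite /alpha; field; rewrite gt_eqF.
  have a18 : 2 * alpha <= 1.
    by rewrite /alpha ler_pdivrMr ?mulr_gt0//; lra.
  have j0R : (J%:R * 2 + 8 : R) <= j%:R.
    by rewrite -natrM -natrD ler_nat muln2 -j0E.
  have J0 : 0 <= (J%:R : R) by exact: ler0n.
  rewrite natrB//; lra.
- rewrite g2; apply: ler_pM => //; rewrite ?sqr_ge0 ?(ltW (powR2_gt0 _))//.
  rewrite powRN lef_pV2 ?posrE ?powR2_gt0//.
  apply: le_trans xj _; apply: ler_powR2; rewrite ler_pM2r// ler_nat.
  exact: leq_addr.
move=> i iK; have [[ki li ti Psii] Psi0] := sepj i iK; split => //.
- apply: wavelet_in_holder_ball => //; first exact: ltW.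
  rewrite (ger0_norm (ltW g0)) /g mulrCA -powR2D.
  apply: le_trans dlM; rewrite ler_piMr ?(ltW dl0)//.
  rewrite -[leRHS](powRr0 2) ler_powR2// -mulrBl.
  by rewrite mulr_le0_ge0 ?subr_le0 ?ler_nat// addr_ge0// ltW.
have -> : (g * Psi (l i) (k i) (t i)) ^+ 2 =
    dl ^+ 2 * kap ^+ 2 * 2 `^ (- (D%:R * q)) * 2 `^ (- (j%:R * (2 * beta))).
  have Psi2 : Psi (l i) (k i) (t i) ^+ 2 = kap ^+ 2 * 2 ^+ j.
    by rewrite -real_normK ?num_real// Psii exprMn sqr_sqrtr// exprn_ge0.
  rewrite exprMn Psi2 g2 -(@powR_mulrn R 2 j)//.
  have -> : - (j%:R * (2 * beta)) = - (j%:R * q) + j%:R by rewrite /q; ring.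
  have -> : - ((j + D)%:R * q) = - (D%:R * q) + - (j%:R * q).
    by rewrite natrD; ring.
  by rewrite !powR2D; ring.
have jb : 2 `^ (- (j0.+1%:R * (2 * beta))) * x `^ (- (2 * beta / q)) <=
    2 `^ (- (j%:R * (2 * beta))).
  have bE : q * (2 * beta / q) = 2 * beta by field; rewrite gt_eqF.
  have s0 : 0 <= 2 * beta / q by rewrite divr_ge0 ?mulr_ge0 ?ltW.
  by have := powR2_level s0 x0 jx; rewrite bE.
rewrite /C1.
set u := 2 `^ (- (j0.+1%:R * _)) in jb *; set v := 2 `^ (- (j%:R * _)) in jb *.
set w := x `^ _ in jb *; set c := dl ^+ 2 * _ * _.
have c0 : 0 < c by rewrite !mulr_gt0 ?exprn_gt0 ?powR2_gt0.
have uw0 : 0 < u * w by rewrite mulr_gt0 ?powR_gt0.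
have -> : 4 * (c * u / 8 * w) = c * (u * w / 2) by field.
by rewrite ltr_pM2l//; lra.
Qed.

End spikes.

Lemma expR_le_1D2 (R : realType) (x : R) : 0 <= x -> x <= 2^-1 ->
  expR x <= 1 + 2 * x.
Proof.
move=> x0 x2; have le1 : 1 <= (1 + 2 * x) * expR (- x).
  by have := expR_ge1Dx (- x); nra.
rewrite -(ler_pM2r (expR_gt0 (- x))) -expRD subrr expR0.
exact: le1.
Qed.

Theorem corollary5p1 (R : realType) (Psi : nat -> nat -> R -> R) (beta M : R)
    (PsiB : orthonormal_basis01 Psi) (PsiW : cdv_wavelets Psi)
    (beta_gt0 : 0 < beta) (M_gt0 : 0 < M) :
  exists C c : R, 0 < C /\ 0 < c /\
    forall (d : measure_display) (Omega : measurableType d)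
      (Pr : probability Omega R) (W : {RV Pr >-> cpath R}),
      standard_wiener W ->
    forall (n : nat) (eps : {i01 R}), (2 <= n)%N ->
      (c%:E < minimax_excess (holder_ball Psi beta M) W n eps
         (C * Num.max
            ((n%:R / ln n%:R) `^ (- (2 * beta / (2 * beta + 1))))
            (eps%:num `^ (4 * beta / (2 * beta + 1))))%R)%E.
Proof.
have [C C0 spikes] := spikes_at_scale PsiB PsiW beta_gt0 M_gt0.
exists C, 4^-1; split=> //; split; first by rewrite invr_gt0.
move=> d Omega Pr W WW n eps n2.
apply: (@lt_le_trans _ _ (2^-1)%:E); first by rewrite lte_fin ltf_pV2 ?posrE//
  ltr_nat.
set q := 2 * beta + 1; set s := 2 * beta / q; set alpha := (18 * q)^-1.
have q1 : 1 < q by rewrite /q ltrDr mulr_gt0.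
have n0 : 0 < n%:R :> R by rewrite ltr0n ltnW.
have lnn0 : 0 < ln (n%:R : R) by exact: ln_nat_gt0.
have alpha0 : 0 <= alpha by rewrite invr_ge0 mulr_ge0//; lra.
case: (leP (_ `^ (- s)) (_ `^ (4 * beta / q))) => [le|_].
(* the contamination term dominates: two hypotheses *)
- have e_neq0 : eps%:num != 0.
    have rate0 : 0 < (n%:R / ln n%:R) `^ (- s) by rewrite powR_gt0// divr_gt0.
    have expo0 : 4 * beta / q != 0 by rewrite gt_eqF// divr_gt0 ?mulr_gt0//;
      lra.
    by apply/eqP => e0; move: (lt_le_trans rate0 le); rewrite e0 powR0// ltxx.
  have e0 : 0 < eps%:num by rewrite lt_neqAle eq_sym e_neq0/=.
  have e1 : eps%:num <= 1 by [].
  have e20 : 0 < eps%:num ^+ 2 by rewrite exprn_gt0.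
  have x1 : 1 <= (eps%:num ^+ 2)^-1 by rewrite invf_ge1// exprn_ile1// ltW.
  have [K [l [k [g [t [K0 _ g2 spike]]]]]] := spikes _ x1.
  have [k0 H0 t0 amp _] := spike 0%N K0.
  have rateE : (eps%:num ^+ 2)^-1 `^ (- s) = eps%:num `^ (4 * beta / q).
    rewrite -(powR_inv1 (ltW e20)) -powRrM mulN1r opprK -(powR_mulrn 2 (ltW
      e0)).
    by rewrite -powRrM; congr (_ `^ _); rewrite /s; ring.
  have a9 : 2 * alpha <= 9^-1.
    by rewrite /alpha invfM mulrA ler_pdivrMr; lra.
  apply: (@minimax_excess_two _ _ _ _ W _ _ _ _ _ (eps%:num / 3) (t 0%N) _ H0)
    => //.
  + exact/zero_in_holder_ball/ltW.
  + by rewrite divr_gt0.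
  + by lra.
  + by lra.
  + apply: chi2_le_mono (chi2_le_wavelet PsiB g WW k0).
    have g2e : g ^+ 2 <= 18^-1 * eps%:num ^+ 2.
      rewrite invrK -/q -/alpha in g2; apply: le_trans g2 _.
      by rewrite ler_pM2r//; lra.
    have g20 : 0 <= g ^+ 2 by exact: sqr_ge0.
    have e21 : eps%:num ^+ 2 <= 1 by rewrite exprn_ile1// ltW.
    apply: le_trans (expR_le_1D2 g20 _) _; first by lra.
    rewrite lerD2l; have -> : (eps%:num / 3) ^+ 2 = eps%:num ^+ 2 / 9 by field.
    by lra.
  + by rewrite -rateE.
(* the sampling term dominates: many hypotheses *)
- set x := n%:R / ln n%:R.
  have x1 : 1 <= x by rewrite ler_pdivlMr// mul1r ltW// ln_lt_nat.
  have x0 : 0 < x by lra.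
  have [K [l [k [g [t [K0 Kx g2 spike]]]]]] := spikes _ x1.
  apply: (@minimax_excess_many _ _ _ _ W _ _ _ _
    (fun i y => g * Psi (l i) (k i) y) (expR (g ^+ 2)) K) => //.
  + apply: le_trans Kx; rewrite ler_pM2l// -expRM_natl.
    apply: (@le_trans _ _ (n%:R `^ alpha)).
      rewrite /powR gt_eqF// ler_expR.
      apply: le_trans (_ : n%:R * (alpha / x) <= _); first by rewrite ler_pM2l.
      have -> : n%:R * (alpha / x) = alpha * ln n%:R; last by [].
      by rewrite /x; field; rewrite !gt_eqF.
    rewrite powRrM powR_mulrn; last by rewrite mulr_ge0// ltW.
    apply: (ge0_ler_powR alpha0); rewrite ?nnegrE ?(ltW n0) ?sqr_ge0//.
    exact: nat_le_sqr_ratio.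
  + by move=> i iK; case: (spike i iK).
  + by move=> i iK; case: (spike i iK) => ki *; exact: chi2_le_wavelet.
  + move=> i j iK jK ij; have [_ _ ti amp other] := spike i iK.
    by exists (t i) => //; rewrite (other j)// ?mulr0 ?subr0// eq_sym.
Qed.
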